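(* Let $(\mathbf V,S^* )$ be a monotone sampling scheme, $f:\mathbf V\to[0,\infty)$, let $\hat f_0$ be a partially specified estimator with thresholds $(\rho_v)_{v\in\mathbf V}$, and let $Z\subseteq\mathbf V$. Let $\hat f$ be an extension of $\hat f_0$ that is fully specified for all vectors in $Z$. If $\hat f$ is admissible on $Z$, then for every $v\in Z$ and for almost every $\rho\in(0,\rho_v]$, $$\inf_{z\in Z\cap S^*(\rho,v)}\lambda(\rho,z)\ \le\ \hat f(\rho,v)\ \le\ \sup_{z\in Z\cap S^*(\rho,v)}\lambda(\rho,z),$$ where $\lambda(\rho,z)=\inf_{0\le\eta<\rho}\dfrac{\underline f(\eta,z)-\int_\rho^1\hat f(u,v)\,du}{\rho-\eta}$.
   Context: A monotone sampling scheme consists of a set $\mathbf V$ (the data domain) and a map assigning to each seed $u\in(0,1]$ and data vector $v\in\mathbf V$ a set $S^*(u,v)\subseteq\mathbf V$ with $v\in S^*(u,v)$, such that for each fixed $v$ the set $S^*(u,v)$ is non-decreasing (under inclusion) in $u$. The outcome (sample) $S(u,v)$ of data $v$ with seed $u$ includes the seed $u$, and $S^*(u,v)$ is the set of all data vectors consistent with the outcome: $z\in S^*(u,v)$ implies $S(u,z)=S(u,v)$ and $S^*(u,z)=S^*(u,v)$. Standing assumption: if $z\in S^*(\rho,v)$ then there is $\epsilon>0$ such that $z\in S^*(x,v)$ for all $x\in(\rho-\epsilon,1]\cap(0,1]$. Lower bound function: $\underline f(u,v)=\inf\{f(z): z\in S^*(u,v)\}$ for $u\in(0,1]$, with $\underline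 f(0,v)=\lim_{u\to0^+}\underline f(u,v)$. A partially specified estimator is a function $\hat f\ge0$ defined on a set $\mathcal S$ of outcomes (write $\hat f(u,v)=\hat f(S(u,v))$; integrable in $u$ where specified) such that for every $v\in\mathbf V$ there is $\rho_v\in[0,1]$ with $S(u,v)\in\mathcal S$ for almost every $u>\rho_v$ and $S(u,v)\notin\mathcal S$ for almost every $u\le\rho_v$, and such that $\int_{\rho_v}^1\hat f(u,v)\,du\le f(v)$ if $\rho_v>0$, while $\int_{0}^1\hat f(u,v)\,du=f(v)$ if $\rho_v=0$. If $\rho_v=0$ the estimator is called fully specified for $v$. An extension of a partially specified estimator is a partially specified estimator whose set of specified outcomes contains that of the original and which agrees with it there. For $v$ on which $\hat f$ is fully specified, its variance is $\int_0^1\hat f(u,v)^2du-f(v)^2$. An extension of $\hat f_0$ that is fully specified for all vectors in $Z$ is admissible on $Z$ if any other extension (of $\hat f_0$, fully specified on $Z$) with strictly lower variance on at least one $v\in Z$ has strictly higher variance on at least one $z\in Z$.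
   Formalization: The formal theorem additionally assumes that the variance of f̂ at the vector v of the conclusion is finite; without this the claim fails, e.g. for V=[0,1], f(t)=1−√t, Z={0}, S*(u,t)={s<u} if t<u and {t} otherwise, where every estimator has infinite variance at 0. *)

(* Defs.v *)
From HB Require Import structures.
From mathcomp Require Import all_boot all_order all_algebra.
From mathcomp Require Import all_classical all_reals all_analysis.
Set Implicit Arguments.
Unset Strict Implicit.
Unset Printing Implicit Defensive.
Import Order.TTheory GRing.Theory Num.Theory.
Import numFieldNormedType.Exports.
Local Open Scope classical_set_scope.
Local Open Scope ring_scope.

(* Only seeds in ]0, 1] are meaningful: the values of Sstar and sample at other
   seeds are unconstrained and never used. The "only if" half of
   Sstar_consistent says that the data consistent with an outcome all produce
   that outcome, the "if" half that Sstar collects all of them. *)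
Record monotone_sampling (R : realType) (V : Type) := MonotoneSampling {
  Sstar : R -> V -> set V;
  outcome : Type;
  sample : R -> V -> outcome;
  seed : outcome -> R;
  Sstar_refl : forall u v, 0 < u <= 1 -> Sstar u v v;
  Sstar_mono : forall u x v, 0 < u -> u <= x -> x <= 1 ->
    Sstar u v `<=` Sstar x v;
  seed_sample : forall u v, 0 < u <= 1 -> seed (sample u v) = u;
  Sstar_consistent : forall u v z, 0 < u <= 1 ->
    (Sstar u v z <-> sample u z = sample u v);
  Sstar_open : forall r v z, 0 < r <= 1 -> Sstar r v z ->
    exists2 e : R, 0 < e &
      forall x, r - e < x -> 0 < x <= 1 -> Sstar x v z }.

Lemma Sstar_eq (R : realType) (V : Type) (S : monotone_sampling R V)
    (u : R) (v z : V) :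
  0 < u <= 1 -> Sstar S u v z -> Sstar S u z = Sstar S u v.
Proof.
move=> u01 /(Sstar_consistent _ _ _ u01) zv; apply/seteqP; split=> y.
  by move=> /(Sstar_consistent _ _ _ u01) yz; apply/Sstar_consistent => //; rewrite yz.
by move=> /(Sstar_consistent _ _ _ u01) yv; apply/Sstar_consistent => //; rewrite yv.
Qed.

Section estimators.
Context {R : realType} {V : Type} (S : monotone_sampling R V) (f : V -> R).

(* The completed measure, so that measurability and integrability in the seed
   are those of Lebesgue and ignore all null sets. *)
Local Notation mu := (@completed_lebesgue_measure R).

Definition lower_bound (u : R) (v : V) : R := inf (f @` Sstar S u v).

Definition lower_bound0 (u : R) (v : V) : R :=
  if u == 0 then lim (lower_bound x v @[x --> 0^'+]) else lower_bound u v.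

(* A partial function on outcomes; None means unspecified. *)
Definition pestimator := outcome S -> option R.

Definition specified (e : pestimator) (u : R) (v : V) : bool :=
  isSome (e (sample S u v)).

(* The default value 0 is only met at unspecified outcomes. *)
Definition est (e : pestimator) (u : R) (v : V) : R :=
  odflt 0 (e (sample S u v)).

Definition threshold (e : pestimator) (v : V) (r : R) : Prop :=
  [/\ 0 <= r <= 1,
      {ae mu, forall u : R, u \in `]r, 1] -> specified e u v} &
      {ae mu, forall u : R, u \in `]0, r] -> ~~ specified e u v}].

Definition fully_specified (e : pestimator) (v : V) : Prop := threshold e v 0.

Definition tail_integral (e : pestimator) (r : R) (v : V) : \bar R :=
  (\int[mu]_(u in `]r, 1%R]) (est e u v)%:E)%E.

Definition partial_estimator (e : pestimator) (r : V -> R) : Prop :=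
  (forall o x, e o = Some x -> 0 <= x) /\
  forall v,
    [/\ threshold e v (r v),
        mu.-integrable `]r v, 1] (fun u : R => (est e u v)%:E),
        0 < r v -> (tail_integral e (r v) v <= (f v)%:E)%E &
        r v = 0 -> tail_integral e 0 v = (f v)%:E].

Definition extension (e0 e : pestimator) : Prop :=
  (exists r, partial_estimator e r) /\
  (forall o x, e0 o = Some x -> e o = Some x).

Definition fully_specified_extension (e0 : pestimator) (Z : set V)
    (e : pestimator) : Prop :=
  extension e0 e /\ (forall v, Z v -> fully_specified e v).

(* Possibly +oo, since an estimator need not be square integrable. *)
Definition est_variance (e : pestimator) (v : V) : \bar R :=
  (\int[mu]_(u in `]0%R, 1%R]) ((est e u v) ^+ 2)%:E - ((f v) ^+ 2)%:E)%E.

Definition admissible (e0 : pestimator) (Z : set V) (e : pestimator) : Prop :=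
  forall g, fully_specified_extension e0 Z g ->
    (exists2 v, Z v & (est_variance g v < est_variance e v)%E) ->
    exists2 z, Z z & (est_variance e z < est_variance g z)%E.

(* lambda(r, z), the integral being taken along the data v. *)
Definition lambda (e : pestimator) (v : V) (r : R) (z : V) : \bar R :=
  ereal_inf [set (((lower_bound0 eta z)%:E - tail_integral e r v)
                   * ((r - eta)^-1)%:E)%E | eta in `[0, r[].

End estimators.

(* Main.v *)
Require Import Defs.
From mathcomp Require Import all_boot all_order all_algebra.
From mathcomp Require Import all_classical all_reals all_analysis.
From mathcomp Require Import measurable_realfun ring lra.
Import Order.TTheory GRing.Theory Num.Theory.
Import numFieldNormedType.Exports.
Local Open Scope classical_set_scope.
Local Open Scope ring_scope.
Set Implicit Arguments.
Unset Strict Implicit.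
Unset Printing Implicit Defensive.

(* Suppose that at a left Lebesgue point rho of u |-> est e u v the estimate c
   exceeds sup lambda (the case below inf lambda is symmetric).  For every
   z in Z consistent with v at rho, the mean of the estimates of z over some
   interval ]eta, rho] is then smaller than c by a fixed margin.  Going down
   from rho, clip the estimates to a level c1 < c as long as the outcome is that
   of v and the seed is within h of rho; afterwards pour the removed mass back
   by raising the estimates that are below a level c2 < c1, until the mass is
   exhausted.  This depends on the outcome only.  If z leaves v at the seed
   t < rho, the Lebesgue point makes the removed mass at most a constant times
   rho - t, and the margin provides at least as much room below t, so the
   revised estimator is unbiased on Z.  Moving mass from above c1 to below c2
   lowers the second moment, which contradicts admissibility.  No
   measurability of the sup in rho is needed, since a single Lebesgue point
   suffices. *)

Lemma integrable_setU d (T : measurableType d) (R : realType)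
    (mu : {measure set T -> \bar R}) (A B : set T) (f : T -> \bar R) :
  measurable A -> measurable B -> [disjoint A & B] ->
  mu.-integrable A f -> mu.-integrable B f -> mu.-integrable (A `|` B) f.
Proof.
move=> mA mB AB /integrableP[mAf Af] /integrableP[mBf Bf].
apply/integrableP; split=> [|]; first by apply/measurable_funU.
rewrite ge0_integral_setU//.
- exact: lte_add_pinfty.
- by apply: measurableT_comp => //; apply/measurable_funU.
Qed.

(** * Integrals over half-open intervals *)

Section interval_integral.
Context {R : realType}.
Local Notation mu := (@completed_lebesgue_measure R).
Local Notation cmeasurable := ((@wlength R idfun)^*%mu.-cara.-measurable).
Local Notation cR := (caratheodory_type (@wlength R idfun)^*%mu).
Implicit Types (a b c k : R) (f g : R -> R).

Lemma completed_lebesgue_measureE (A : set R) :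
  mu A = lebesgue_measure (A : set (measurableTypeR R)).
Proof. by []. Qed.

Lemma measurable_completed (A : set R) :
  measurable (A : set (measurableTypeR R)) -> cmeasurable A.
Proof. move=> mA; exact (@sub_caratheodory _ _ _ (@wlength R idfun) A mA). Qed.

Lemma cmeasurable_itv (i : interval R) : cmeasurable [set` i].
Proof. exact (@measurable_completed [set` i] (measurable_itv i)). Qed.
Hint Resolve cmeasurable_itv : core.

Lemma mu_itvoc a b : a <= b -> mu `]a, b] = (b - a)%:E.
Proof.
rewrite le_eqVlt => /predU1P[->|ab].
  by rewrite set_itvoc0 measure0 subrr.
by rewrite completed_lebesgue_measureE lebesgue_measure_itv/= lte_fin ab EFinB.
Qed.

Lemma mu_itvoc_lty a b : (mu `]a, b] < +oo)%E.
Proof.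
rewrite completed_lebesgue_measureE lebesgue_measure_itv/=.
by case: ifP => _; rewrite -?EFinB ?ltry.
Qed.

Lemma mu_set1 a : mu [set a] = 0%E.
Proof. by rewrite completed_lebesgue_measureE lebesgue_measure_set1. Qed.

Definition Iint a b f : R := \int[mu]_(x in `]a, b]) f x.
Definition integ a b f : Prop := mu.-integrable `]a, b] (EFin \o f).

Lemma Iint_EFin a b f : integ a b f ->
  (\int[mu]_(x in `]a, b]) (f x)%:E)%E = (Iint a b f)%:E.
Proof. by move=> fi; rewrite fineK//; exact: integrable_fin_num. Qed.

Lemma integS a b a' b' f : a <= a' -> b' <= b -> integ a b f -> integ a' b' f.
Proof.
move=> aa bb; apply: integrableS => // x/=; rewrite !in_itv/= => /andP[ax xb].
by rewrite (le_lt_trans aa)// (le_trans xb).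
Qed.

Lemma integ_eq a b f g : (forall x, a < x <= b -> f x = g x) ->
  integ a b f -> integ a b g.
Proof.
move=> fg; apply: eq_integrable => // x; rewrite inE/= in_itv/= => /fg ->//.
Qed.

Lemma Iint_eq a b f g : (forall x, a < x <= b -> f x = g x) ->
  Iint a b f = Iint a b g.
Proof.
move=> fg; apply: eq_Rintegral => x; rewrite inE/= in_itv/= => /fg ->//.
Qed.

Lemma integ_measurable a b f :
  integ a b f -> measurable_fun (`]a, b] : set cR) f.
Proof. by move=> /measurable_int/measurable_EFinP. Qed.

Lemma integD a b f g : integ a b f -> integ a b g -> integ a b (fun x => f x + g x).
Proof. by move=> fi gi; exact: (integrableD _ fi gi). Qed.

Lemma integB a b f g : integ a b f -> integ a b g -> integ a b (fun x => f x - g x).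
Proof. by move=> fi gi; exact: (integrableB _ fi gi). Qed.

Lemma integZ a b k f : integ a b f -> integ a b (fun x => k * f x).
Proof. by move=> fi; exact: (integrableZl _ k fi). Qed.

Lemma integ_norm a b f : integ a b f -> integ a b (fun x => `|f x|).
Proof. by move=> fi; apply: integrable_norm. Qed.

Lemma integ_cst a b k : integ a b (fun=> k).
Proof.
apply: measurable_bounded_integrable => //; last first.
  by exists `|k|; split=> // M kM x _; exact: ltW.
exact: mu_itvoc_lty.
Qed.

Lemma integ_le a b f g :
  measurable_fun (`]a, b] : set cR) f -> (forall x, a < x <= b -> `|f x| <= g x) ->
  integ a b g -> integ a b f.
Proof.
move=> mf fg; apply: le_integrable => //; first exact/measurable_EFinP.
move=> x/=; rewrite in_itv/= => /fg fgx.
by rewrite lee_fin (le_trans fgx)// ler_norm.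
Qed.

Lemma integ_max a b f g : integ a b f -> integ a b g ->
  integ a b (fun x => Num.max (f x) (g x)).
Proof.
move=> fi gi; apply: (integ_le _ _ (integD (integ_norm fi) (integ_norm gi))).
  by apply: measurable_maxr; exact: integ_measurable.
by move=> x _; rewrite maxEle; case: ifP => _; rewrite ?lerDl ?lerDr.
Qed.

Lemma integ_cat a b c f : a <= b -> b <= c ->
  integ a b f -> integ b c f -> integ a c f.
Proof.
move=> ab bc fab fbc; rewrite /integ (@itv_bndbnd_setU _ _ _ (BRight b)) ?bnd_simp//.
apply: integrable_setU => //; apply/disj_setPS => x/=.
by rewrite !in_itv/= => -[/andP[_ xb] /andP[]]; rewrite ltNge xb.
Qed.

Lemma Iint_cat b a c f : a <= b -> b <= c -> integ a c f ->
  Iint a c f = Iint a b f + Iint b c f.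
Proof.
move=> ab bc; rewrite /integ /Iint.
rewrite (@itv_bndbnd_setU _ _ (BRight a) (BRight b) (BRight c)) ?bnd_simp// => fac.
rewrite Rintegral_setU//; apply/disj_setPS => x/=.
by rewrite !in_itv/= => -[/andP[_ xb] /andP[]]; rewrite ltNge xb.
Qed.

Lemma Iint_D a b f g : integ a b f -> integ a b g ->
  Iint a b (fun x => f x + g x) = Iint a b f + Iint a b g.
Proof. by move=> fi gi; apply: RintegralD. Qed.

Lemma Iint_B a b f g : integ a b f -> integ a b g ->
  Iint a b (fun x => f x - g x) = Iint a b f - Iint a b g.
Proof. by move=> fi gi; apply: RintegralB. Qed.

Lemma Iint_Z a b k f : integ a b f ->
  Iint a b (fun x => k * f x) = k * Iint a b f.
Proof. by move=> fi; apply: RintegralZl. Qed.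

Lemma Iint_cst a b k : a <= b -> Iint a b (fun=> k) = k * (b - a).
Proof. by move=> ab; rewrite /Iint Rintegral_cst// [X in fine X]mu_itvoc. Qed.

Lemma Iint_cstB a b k f : a <= b -> integ a b f ->
  Iint a b (fun x => k - f x) = k * (b - a) - Iint a b f.
Proof.
by move=> ab fi; rewrite -Iint_cst//; exact: (Iint_B (integ_cst a b k) fi).
Qed.

Lemma Iint_Bcst a b k f : a <= b -> integ a b f ->
  Iint a b (fun x => f x - k) = Iint a b f - k * (b - a).
Proof.
by move=> ab fi; rewrite -Iint_cst//; exact: (Iint_B fi (integ_cst a b k)).
Qed.

Lemma Iint_cstD a b k f : a <= b -> integ a b f ->
  Iint a b (fun x => k + f x) = k * (b - a) + Iint a b f.
Proof.
by move=> ab fi; rewrite -Iint_cst//; exact: (Iint_D (integ_cst a b k) fi).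
Qed.

Lemma Iint_le a b f g : integ a b f -> integ a b g ->
  (forall x, a < x <= b -> f x <= g x) -> Iint a b f <= Iint a b g.
Proof.
by move=> fi gi fg; apply: le_Rintegral => // x/=; rewrite in_itv/= => /fg.
Qed.

Lemma Iint_ge0 a b f : (forall x, a < x <= b -> 0 <= f x) -> 0 <= Iint a b f.
Proof. by move=> f0; apply: Rintegral_ge0 => x/=; rewrite in_itv/= => /f0. Qed.

Lemma Iint_nil a f : Iint a a f = 0.
Proof. by rewrite /Iint set_itvoc0 Rintegral_set0. Qed.

Lemma Iint_leS a b a' b' f : a <= a' -> a' <= b' -> b' <= b -> integ a b f ->
  (forall x, a < x <= b -> 0 <= f x) -> Iint a' b' f <= Iint a b f.
Proof.
move=> aa ab bb fi f0.
rewrite (@Iint_cat a' a b)//; last exact: le_trans ab bb.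
rewrite (@Iint_cat b' a' b)//; last exact: integS fi.
have h1 : 0 <= Iint a a' f.
  apply: Iint_ge0 => x /andP[ax xa]; apply: f0.
  by rewrite ax (le_trans xa)// (le_trans ab).
have h2 : 0 <= Iint b' b f.
  apply: Iint_ge0 => x /andP[bx xb]; apply: f0.
  by rewrite xb andbT (le_lt_trans _ bx)// (le_trans aa).
lra.
Qed.

Lemma integ_restrict a b f : integ a b f ->
  mu.-integrable setT (EFin \o (f \_ `]a, b])).
Proof.
move=> fi; rewrite -restrict_EFin.
exact ((integrable_mkcond (EFin \o f : cR -> \bar R) (cmeasurable_itv _)).1 fi).
Qed.

Lemma Iint_norm_cont a b f (e : R) : integ a b f -> 0 < e ->
  exists2 d, 0 < d & forall x y, a <= x -> x <= y -> y <= b -> y - x < d ->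
    Iint x y (fun u => `|f u|) < e.
Proof.
move=> fi e0.
have fT := integ_restrict fi.
have [d [d0 dP]] := integral_normr_continuous fT e0.
exists d => // x y ax xy yb xyd.
rewrite (_ : Iint x y _ = \int[mu]_(u in `]x, y]) `|(f \_ `]a, b]) u|).
  by apply: dP => //; rewrite [X in (X < _)%E]mu_itvoc// lte_fin.
apply: eq_Rintegral => u; rewrite inE/= in_itv/= => /andP[xu uy].
by rewrite patchE mem_set//= in_itv/= (le_lt_trans ax xu) (le_trans uy yb).
Qed.

Lemma ae_imp (P Q : R -> Prop) : (forall u, P u -> Q u) ->
  {ae mu, forall u : R, P u} -> {ae mu, forall u : R, Q u}.
Proof. by move=> PQ h; apply: (@filterS _ _ (ae_filter_ringOfSetsType mu) P Q PQ h). Qed.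

Lemma ae_and (P Q : R -> Prop) : {ae mu, forall u : R, P u} ->
  {ae mu, forall u : R, Q u} -> {ae mu, forall u : R, P u /\ Q u}.
Proof. by move=> p q; apply: (@filterI _ _ (ae_filter_ringOfSetsType mu) P Q p q). Qed.

(** The measure is complete, so a function agreeing almost everywhere with the measurable [f] is
    itself measurable. This transfers integrability to estimates known only up to a null set. *)
Lemma ae_Iint a b f g :
  {ae mu, forall u : R, a < u <= b -> f u = g u} ->
  integ a b f -> integ a b g /\ Iint a b f = Iint a b g.
Proof.
move=> fg fi.
have aefg : ae_eq mu (`]a, b]%classic : set cR) (EFin \o f) (EFin \o g).
  by move: fg; apply: ae_imp => u fgu /=; rewrite in_itv/= => /fgu ->.
have mg : measurable_fun (`]a, b] : set cR) (EFin \o g).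
  apply: (ae_measurable_fun _ aefg); last exact: measurable_int fi.
  exact: measure_is_complete_caratheodory.
have fgE : (\int[mu]_(x in `]a, b]) (f x)%:E = \int[mu]_(x in `]a, b]) (g x)%:E)%E.
  apply: ae_eq_integral aefg; [exact: cmeasurable_itv| |exact: mg].
  exact: measurable_int fi.
split; last by congr fine.
apply/integrableP; split=> //; case/integrableP : (fi) => mf; apply: le_lt_trans.
rewrite le_eqVlt; apply/orP; left; apply/eqP.
apply: ge0_ae_eq_integral.
- exact: cmeasurable_itv.
- exact: measurableT_comp.
- exact: measurableT_comp.
- by move=> u _; exact: abse_ge0.
- by move=> u _; exact: abse_ge0.
- by move: aefg; apply: ae_imp => u fgu Du; congr abse; exact/esym/fgu.
Qed.

(** If the mass on []x, t]] reaches [m], take for [y] the supremum of the points above which there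
    is mass at least [m]: continuity of the integral in its lower endpoint makes the mass on []y,
    t]] exactly [m]. Otherwise [y] is [x]. The strict bound above [y] and the weak one up to [y]
    match the test in [revised]. *)
Lemma level_cut (x t m : R) f : x <= t -> 0 <= m -> integ x t f ->
  (forall u, x < u <= t -> 0 <= f u) ->
  exists y, [/\ x <= y <= t, forall u, y < u <= t -> Iint u t f < m,
    forall u, x < u <= y -> m <= Iint u t f, Iint y t f <= m &
    Iint y t f < m -> y = x].
Proof.
move=> xt m0 fi f0.
have mono u w : x <= u -> u <= w -> w <= t -> Iint w t f <= Iint u t f.
  move=> xu uw wt; apply: Iint_leS => //; first exact: integS fi.
  by move=> z /andP[uz zt]; rewrite f0// zt (le_lt_trans xu).
have [xm|mx] := ltP (Iint x t f) m.
  exists x; split=> //; first by rewrite lexx.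
  - by move=> u /andP[xu ut]; rewrite (le_lt_trans _ xm)// mono// ltW.
  - by move=> u /andP[xu ux]; move: (lt_le_trans xu ux); rewrite ltxx.
  - exact: ltW.
pose A := [set u | x <= u <= t /\ m <= Iint u t f].
have Ax : A x by split; rewrite // lexx.
have supA : has_sup A.
  by split; [exists x|exists t => u [/andP[_]]].
pose y := sup A.
have xy : x <= y by exact: ub_le_sup supA.2 _ Ax.
have yt : y <= t by apply: ge_sup => [|u [/andP[_]]//]; exists x.
have cont e : 0 < e -> exists2 d, 0 < d & forall u w, x <= u -> u <= w ->
    w <= t -> w - u < d -> Iint u t f - Iint w t f < e.
  move=> e0; have [d d0 dP] := Iint_norm_cont fi e0.
  exists d => // u w xu uw wt wud.
  rewrite (@Iint_cat w u t)//; last exact: integS fi.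
  rewrite addrK (_ : Iint u w f = Iint u w (fun z => `|f z|)); first exact: dP.
  apply: Iint_eq => z /andP[uz zw]; rewrite ger0_norm// f0//.
  by rewrite (le_lt_trans xu)// (le_trans zw).
have above u : y < u <= t -> Iint u t f < m.
  move=> /andP[yu ut]; rewrite ltNge; apply/negP => mu.
  have : u <= y by apply: (ub_le_sup supA.2); split=> //; rewrite ut (le_trans xy)// ltW.
  by rewrite leNgt yu.
have ym : m <= Iint y t f.
  rewrite leNgt; apply/negP => ym.
  have [|d d0 dP] := cont (m - Iint y t f); first by rewrite subr_gt0.
  have [u [/andP[xu ut] mu] yu] := sup_adherent d0 supA.
  have uy : u <= y by apply: (ub_le_sup supA.2); split=> //; rewrite xu.
  have yu' : y - d < u by exact: yu.
  have yud : y - u < d by lra.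
  by have := dP u y xu uy yt yud; lra.
have my : Iint y t f <= m.
  rewrite leNgt; apply/negP => ym'.
  have yltt : y < t.
    by rewrite lt_neqAle yt andbT; apply/eqP => yE; move: ym'; rewrite yE Iint_nil; lra.
  have [|d d0 dP] := cont (Iint y t f - m); first by rewrite subr_gt0.
  (* A point just above [y], where by continuity the mass would still exceed [m], against
     [above]. *)
  pose w := Num.min t (y + d / 2).
  have yw : y < w by rewrite lt_min yltt/=; lra.
  have wt : w <= t by rewrite ge_min lexx.
  have wyd : w - y < d.
    have : w <= y + d / 2 by rewrite ge_min lexx orbT.
    by lra.
  have := dP y w xy (ltW yw) wt wyd.
  have := above w; rewrite yw wt => /(_ isT); lra.
exists y; split=> //; first by rewrite xy.
- by move=> u /andP[xu uy]; rewrite (le_trans ym)// mono// ltW.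
- by rewrite ltNge ym.
Qed.


(** * Completed and Borel Lebesgue measure; left Lebesgue points *)

Lemma ae_completed (P : R -> Prop) :
  {ae @lebesgue_measure R, forall u : R, P u} -> {ae mu, forall u : R, P u}.
Proof.
move=> [A [mA A0 sA]]; exists A; split => //; first exact: measurable_completed.
Qed.

(** The identity from the completed to the Borel sigma-algebra is measurable and pushes [mu] forward
    to [lebesgue_measure]. *)
Lemma ge0_integral_completed (D : set R) (h : R -> \bar R) :
  measurable (D : set (measurableTypeR R)) ->
  measurable_fun (D : set (measurableTypeR R)) h -> (forall x, 0 <= h x)%E ->
  (\int[@lebesgue_measure R]_(x in D) h x = \int[mu]_(x in D) h x)%E.
Proof.
move=> mD mh h0.
have mid : measurable_fun (setT : set cR) (idfun : cR -> measurableTypeR R).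
  by move=> _ B mB; rewrite setTI; exact: measurable_completed.
have := @ge0_integral_pushforward _ _ _ _ _ _ mid mu D h mD mh (fun x _ => h0 x).
by move=> <-; apply: eq_measure_integral.
Qed.

(** For each rational level the sublevel set of [f] is Borel up to a Borel null set. Off the
    countable union [N] of these null sets all sublevel sets are Borel, and [f] is set to [0] on
    [N]. *)
Lemma borel_representative f : measurable_fun (setT : set cR) f ->
  exists (g : R -> R) (N : set R),
    [/\ measurable_fun (setT : set (measurableTypeR R)) g,
      measurable (N : set (measurableTypeR R)), lebesgue_measure N = 0%E &
      forall x, ~ N x -> f x = g x].
Proof.
move=> mf.
pose q n : R := ratr (odflt 0 (unpickle n : option rat)).
have qP x y : x < y -> exists n, x < q n < y.
  move=> /rat_in_itvoo[r rxy]; exists (pickle r).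
  by rewrite /q pickleK/=; move: rxy; rewrite in_itv.
have cover n : exists AN : set R * set R,
    [/\ measurable (AN.1 : set (measurableTypeR R)),
      measurable (AN.2 : set (measurableTypeR R)),
      lebesgue_measure AN.2 = 0%E &
      forall x, ~ AN.2 x -> (AN.1 x <-> f x < q n)].
  have : cmeasurable (f @^-1` `]-oo, q n[).
    by have := mf measurableT `]-oo, q n[%classic (measurable_itv _); rewrite setTI.
  rewrite -completed_caratheodory_measurable g_sigma_completed_algebra_genE.
  move=> [A mA [N [B [mB B0 NB]] ANE]]; exists (A, B); split=> //= x Bx.
  have -> : (f x < q n) = (f @^-1` `]-oo, q n[) x :> Prop by rewrite /= in_itv.
  by rewrite -ANE; split=> [|[//|/NB]]; [left|].
have [AN ANP] := choice cover.
pose N := \bigcup_n (AN n).2.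
have mN : measurable (N : set (measurableTypeR R)).
  by apply: bigcupT_measurable => n; case: (ANP n).
have N0 : lebesgue_measure N = 0%E.
  apply/negligibleP => //; apply: negligible_bigcup => n.
  by case: (ANP n) => ? ? ? _; apply/negligibleP.
exists (f \_ (~` N)), N; split=> //; last first.
  by move=> x Nx; rewrite patchE mem_set.
apply/(measurable_restrictT _ _).1; first exact: measurableC.
apply: (measurability _ (RGenInftyO.measurableE R)) => // _ [_ [x ->] <-].
rewrite (_ : _ `&` _ = \bigcup_n (if q n < x then (AN n).1 `\` N else set0)).
  apply: bigcupT_measurable => n; case: ifP => // _.
  by apply: measurableD => //; case: (ANP n).
apply/seteqP; split=> [u [Nu]|u [n _]].
  rewrite /= in_itv/= => /qP[n /andP[un nx]]; exists n => //; rewrite nx.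
  split=> //; case: (ANP n) => _ _ _ ->// ?; apply: Nu; exists n => //.
case: ifP => // nx [Au Nu]; split=> //.
rewrite /= in_itv/= (lt_trans _ nx)//; case: (ANP n) => _ _ _ <-// ?.
by apply: Nu; exists n.
Qed.

(** Lebesgue differentiation is applied to a Borel representative of [f] cut off outside []a, b]],
    on balls centred at [p], each of which contains the left interval []t, p]] of the same
    radius. *)
Lemma ae_left_lebesgue_pt a b f : integ a b f ->
  {ae mu, forall p : R, a < p <= b -> forall e, 0 < e ->
    exists2 h, 0 < h & forall t, a <= t -> p - h <= t -> t < p ->
      Iint t p (fun u => `|f u - f p|) <= e * (p - t)}.
Proof.
move=> fi; pose F := f \_ `]a, b].
have FT : mu.-integrable setT (EFin \o F) by exact: integ_restrict.
have mF : measurable_fun (setT : set cR) F by have /measurable_int/measurable_EFinP := FT.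
have [g [N [mg mN N0 Fg]]] := borel_representative mF.
have aeN : {ae mu, forall u : R, ~ N u}.
  exists N; split=> //; [exact: measurable_completed|by move=> u /= /contrapT].
have gi : (@lebesgue_measure R).-integrable setT (EFin \o g).
  apply/integrableP; split; first exact/measurable_EFinP.
  rewrite ge0_integral_completed//; last first.
    by apply: measurableT_comp => //; exact/measurable_EFinP.
  have mgc : measurable_fun (setT : set cR) g.
    by move=> _ B mB; exact (measurable_completed (mg measurableT B mB)).
  have mabs (h : R -> R) : measurable_fun (setT : set cR) h ->
      measurable_fun (setT : set cR) (abse \o (EFin \o h)).
    by move=> mh; apply: measurableT_comp; [exact: abse_measurable|exact/measurable_EFinP].
  case/integrableP : FT => mEF; apply: le_lt_trans.
  rewrite le_eqVlt; apply/orP; left; apply/eqP.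
  apply: ge0_ae_eq_integral.
  - exact: measurableT.
  - exact: (mabs g mgc).
  - exact: (mabs F mF).
  - by move=> x _; exact: abse_ge0.
  - by move=> x _; exact: abse_ge0.
  - by move: aeN; apply: ae_imp => u Nu _ /=; rewrite Fg.
have /lebesgue_differentiation/ae_completed : locally_integrable setT g.
  by have := integrable_locally measurableT gi; rewrite patch_setT.
move=> /(ae_and aeN); apply: ae_imp => p [Np gp] /andP[ap pb] e e0.
(* The ball is twice as long as the interval []t, p]], hence half of [e]. *)
have e2 : 0 < e / 2 by rewrite divr_gt0.
have /gp[/= h h0 hP] : nbhs (0%E : \bar R) [set x | (x < (e / 2)%:E)%E].
  exists (e / 2) => //= x /=; rewrite sub0r normrN lte_fin.
  by move=> /(le_lt_trans (ler_norm _)).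
(* The radius [p - t] must be strictly below [h], while [t] is only bounded weakly. *)
exists (h / 2); first by rewrite divr_gt0.
move=> t at_ pt tp; set r := p - t.
have r0 : 0 < r by rewrite subr_gt0.
have := hP r; rewrite /= sub0r normrN gtr0_norm// => /(_ _ r0).
have rh : r < h by rewrite /r; lra.
move=> /(_ rh); rewrite /davg /iavg (lebesgue_measure_ball _ (ltW r0)).
rewrite inver mulrn_eq0/= gt_eqF//= lte_pdivrMl ?mulrn_wgt0// -EFinM.
rewrite (_ : r *+ 2 * (e / 2) = e * r); last first.
  by lra.
have mball : measurable (ball p r : set (measurableTypeR R)) by exact: measurable_ball.
have mEgp : measurable_fun (ball p r : set (measurableTypeR R))
    (fun u => `|(g u - g p)%:E|%E).
  by apply: measurable_funTS; apply: measurableT_comp => //; apply/measurable_EFinP;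
    exact: measurable_funB.
move=> /ltW; rewrite ge0_integral_completed//.
have fgp : {ae mu, forall u : R, t < u <= p -> `|f u - f p| = `|g u - g p|}.
  move: aeN; apply: ae_imp => u Nu /andP[tu up].
  have FE x : a < x <= b -> F x = f x by move=> axb; rewrite /F patchE mem_set//= in_itv.
  by rewrite -!Fg// !FE ?ap// (le_lt_trans at_ tu) (le_trans up pb).
have fip : integ t p (fun u => `|f u - f p|).
  by apply: integ_norm; apply: integB; [exact: integS fi|exact: integ_cst].
have [gip IE] := ae_Iint fgp fip.
rewrite -lee_fin IE -(Iint_EFin gip); apply: le_trans.
apply: ge0_subset_integral.
- exact: cmeasurable_itv.
- exact: measurable_completed.
- by move=> _ B mB; exact (measurable_completed (mEgp mball B mB)).
- by move=> x _ /=; rewrite ?abse_ge0 ?lee_fin ?normr_ge0. 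
- move=> x /=; rewrite in_itv/= => /andP[tx xp].
  by rewrite /ball/= ger0_norm ?subr_ge0// /r ltrD2l ltrN2.
Qed.
End interval_integral.

(** * Moving mass along the seed axis *)

Section signed_excess.
Context {R : realType}.
Implicit Types (s k u : R) (phi : R -> R).

(** The positive part of [phi - k] for [s = 1] and of [k - phi] for [s = -1], so that both halves of
    the theorem share one argument. Subtracting [s * excess] clips [phi] at [k], from above or from
    below. *)
Definition excess s k phi u : R := Num.max (s * (phi u - k)) 0.

Lemma excess_ge0 s k phi u : 0 <= excess s k phi u.
Proof. by rewrite /excess le_max lexx orbT. Qed.

Lemma excess_ge s k phi u : s * (phi u - k) <= excess s k phi u.
Proof. by rewrite /excess le_max lexx. Qed.

Lemma integ_excess a b s k phi : integ a b phi -> integ a b (excess s k phi).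
Proof.
by move=> fi; apply: integ_max; [apply: integZ; apply: integB|]; rewrite //; exact: integ_cst.
Qed.

Lemma excess_removeP s k phi u : s = 1 \/ s = -1 ->
  let g := phi u - s * excess s k phi u in
  (phi u = g /\ excess s k phi u = 0) \/ (g = k /\ excess s k phi u = s * (phi u - k)).
Proof.
move=> hs /=; rewrite /excess maxEle; case: ifP => _; first by left; rewrite mulr0 subr0.
by right; split=> //; case: hs => ->; lra.
Qed.

Lemma excess_removed_ge0 s k phi u : s = 1 \/ s = -1 -> 0 <= k -> 0 <= phi u ->
  0 <= phi u - s * excess s k phi u.
Proof. by move=> /(@excess_removeP _ k phi u)/= [[<- _]|[->]]. Qed.

(** Where clipping acts, [phi ^ 2 - k ^ 2] exceeds [2 * k * (phi - k)] by the square of [phi - k].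
    The bound is linear in the moved mass. *)
Lemma excess_removed_sqr s k phi u : s = 1 \/ s = -1 ->
  (phi u - s * excess s k phi u) ^+ 2 <= phi u ^+ 2 - 2 * s * k * excess s k phi u.
Proof.
move=> hs; have /= := @excess_removeP s k phi u hs; set g := _ - _.
case=> [[<- ->]|[-> ->]]; first by rewrite mulr0 subr0.
have := sqr_ge0 (phi u - k); case: hs => ->; rewrite !expr2; lra.
Qed.

End signed_excess.

(* For [s = 1] mass is removed from phi above the level [c1] on the window
   ]t, rho] and poured back below the level [c2] on ]y, t]; for [s = -1] it is
   added on the window and taken back. *)
Record mass_transfer (R : realType) (s rho t y c1 c2 : R) (phi g : R -> R) : Prop :=
  MassTransfer {
  transfer_t_ge0 : 0 <= t;
  transfer_t_lt : t < rho;
  transfer_y_ge0 : 0 <= y;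
  transfer_y_le : y <= t;
  transfer_window : forall u, t < u <= rho -> g u = phi u - s * excess s c1 phi u;
  transfer_fill : forall u, y < u <= t -> g u = phi u + s * excess (- s) c2 phi u;
  transfer_rest : forall u, 0 < u <= y -> g u = phi u;
  transfer_fill_le : Iint y t (excess (- s) c2 phi) <= Iint t rho (excess s c1 phi);
  transfer_fill_end :
    Iint y t (excess (- s) c2 phi) < Iint t rho (excess s c1 phi) -> y = 0 }.

Section mass_transfer.
Context {R : realType}.
Variables (s rho t y c1 c2 : R) (phi g : R -> R).
Hypothesis tr : mass_transfer s rho t y c1 c2 phi g.
Hypothesis phi_int : integ 0 rho phi.
Let mo := excess s c1 phi.
Let ro := excess (- s) c2 phi.
Let m := Iint t rho mo.
Let t0 := transfer_t_ge0 tr.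
Let trho := transfer_t_lt tr.
Let y0 := transfer_y_ge0 tr.
Let yt := transfer_y_le tr.
Let g_window := transfer_window tr.
Let g_fill := transfer_fill tr.
Let g_rest := transfer_rest tr.
Let fill_le := transfer_fill_le tr.

Let phi_sub (a b : R) : 0 <= a -> b <= rho -> integ a b phi.
Proof. by move=> a0 br; exact: integS phi_int. Qed.

Let mo_int (a b : R) : 0 <= a -> b <= rho -> integ a b mo.
Proof. by move=> a0 br; apply/integ_excess/phi_sub. Qed.

Let ro_int (a b : R) : 0 <= a -> b <= rho -> integ a b ro.
Proof. by move=> a0 br; apply/integ_excess/phi_sub. Qed.

Let g_int_window a : t <= a -> integ a rho g.
Proof.
move=> ta; apply: (@integ_eq _ _ _ (fun u => phi u - s * mo u)).
  by move=> u /andP[au ur]; rewrite g_window// ur (le_lt_trans ta).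
have a0 : 0 <= a by exact: le_trans ta.
by apply: integB; [exact: phi_sub|apply: integZ; exact: mo_int].
Qed.

Let g_int_fill a : y <= a -> integ a t g.
Proof.
move=> ya; apply: (@integ_eq _ _ _ (fun u => phi u + s * ro u)).
  by move=> u /andP[au ur]; rewrite g_fill// ur (le_lt_trans ya).
have a0 : 0 <= a by exact: le_trans ya.
by apply: integD; [apply: phi_sub|apply: integZ; apply: ro_int]; rewrite // ltW.
Qed.

Let g_int_rest (a : R) : 0 <= a -> integ a y g.
Proof.
move=> a0; apply: (@integ_eq _ _ _ phi).
  by move=> u /andP[au ur]; rewrite g_rest// ur (le_lt_trans a0).
by apply: phi_sub => //; rewrite (le_trans yt)// ltW.
Qed.

Lemma transfer_integ : integ 0 rho g.
Proof.
have yr : y <= rho by rewrite (le_trans yt)// ltW.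
apply: (@integ_cat _ _ y) => //; first exact: g_int_rest.
by apply: (@integ_cat _ _ t) => //; [exact: ltW|exact: g_int_fill|exact: g_int_window].
Qed.

Lemma Iint_window (x : R) : t <= x -> x <= rho ->
  Iint x rho g = Iint x rho phi - s * Iint x rho mo.
Proof.
move=> tx xr; have x0 : 0 <= x by exact: le_trans tx.
rewrite -Iint_Z; last exact: mo_int.
rewrite -Iint_B; [|exact: phi_sub|by apply: integZ; exact: mo_int].
by apply: Iint_eq => u /andP[xu ur]; rewrite g_window// ur (le_lt_trans tx).
Qed.

Lemma Iint_fill (x : R) : y <= x -> x <= t ->
  Iint x rho g = Iint x rho phi - s * m + s * Iint x t ro.
Proof.
move=> yx xt; have x0 : 0 <= x by exact: le_trans yx.
rewrite (@Iint_cat _ t x)//; [|exact: ltW|]; last first.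
  by apply: integS transfer_integ.
rewrite (@Iint_cat _ t x rho phi)//; [|exact: ltW|exact: phi_sub].
rewrite Iint_window ?(ltW trho)// -/m.
rewrite (_ : Iint x t g = Iint x t phi + s * Iint x t ro); first lra.
rewrite -Iint_Z; last by apply: ro_int => //; exact: ltW.
rewrite -Iint_D; [|by apply: phi_sub => //; exact: ltW|].
  by apply: Iint_eq => u /andP[xu ur]; rewrite g_fill// ur (le_lt_trans yx).
by apply: integZ; apply: ro_int => //; exact: ltW.
Qed.

Lemma Iint_rest (x : R) : 0 <= x -> x <= y ->
  Iint x rho g = Iint x rho phi - s * m + s * Iint y t ro.
Proof.
move=> x0 xy; have yr : y <= rho by rewrite (le_trans yt)// ltW.
rewrite (@Iint_cat _ y x)//; last by apply: integS transfer_integ.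
rewrite (@Iint_cat _ y x rho phi)//; last exact: phi_sub.
rewrite Iint_fill// (_ : Iint x y g = Iint x y phi); first lra.
by apply: Iint_eq => u /andP[xu ur]; rewrite g_rest// ur (le_lt_trans x0).
Qed.

Lemma transfer_balanced (x : R) : 0 <= x -> x <= y -> Iint y t ro = m ->
  Iint x rho g = Iint x rho phi.
Proof. by move=> x0 xy yE; rewrite Iint_rest// yE; lra. Qed.

(** For [s = 1], going down from [rho], mass is first removed and then poured back, never more than
    was removed. *)
Lemma transfer_delayed (x : R) : s = 1 -> 0 <= x -> x <= rho ->
  Iint x rho g <= Iint x rho phi.
Proof.
move=> s1 x0 xr; have [xy|/ltW yx] := leP x y.
  by rewrite Iint_rest// s1; move: (fill_le : Iint y t ro <= m); lra.
have [xt|/ltW tx] := leP x t.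
  rewrite Iint_fill// s1.
  have : Iint x t ro <= Iint y t ro.
    apply: Iint_leS => //; first by apply: ro_int => //; exact: ltW.
    by move=> *; exact: excess_ge0.
  by move: (fill_le : Iint y t ro <= m); lra.
rewrite Iint_window// s1.
have : 0 <= Iint x rho mo by apply: Iint_ge0 => *; exact: excess_ge0.
by lra.
Qed.

(** By [excess_removed_sqr], moving the mass [m] changes the second moment by at most
    [- 2 * s * c1 * m] on the window and [2 * s * c2 * m] where it is poured back. *)
Lemma transfer_sqr : s = 1 \/ s = -1 ->
  integ 0 rho (fun u => phi u ^+ 2) -> Iint y t ro = m ->
  integ 0 rho (fun u => g u ^+ 2) /\
  Iint 0 rho (fun u => g u ^+ 2) <=
    Iint 0 rho (fun u => phi u ^+ 2) - 2 * (s * (c1 - c2)) * m.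
Proof.
move=> hs phi2 yE; have yr : y <= rho by rewrite (le_trans yt)// ltW.
(* A pointwise majorant of [g ^ 2], linear in the excesses, so that only the masses enter its
   integral. *)
pose B u := phi u ^+ 2 + (if t < u then - (2 * s * c1) * mo u
   else if y < u then 2 * s * c2 * ro u else 0).
have B1 : forall u, t < u <= rho -> phi u ^+ 2 + - (2 * s * c1) * mo u = B u.
  by move=> u /andP[tu _]; rewrite /B tu.
have B2 : forall u, y < u <= t -> phi u ^+ 2 + 2 * s * c2 * ro u = B u.
  by move=> u /andP[yu ut]; rewrite /B ltNge ut/= yu.
have B3 : forall u, 0 < u <= y -> phi u ^+ 2 = B u.
  by move=> u /andP[_ uy]; rewrite /B !ltNge uy (le_trans uy yt)/= addr0.
have I1 : integ t rho (fun u => phi u ^+ 2 + - (2 * s * c1) * mo u).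
  by apply: integD; [exact: integS phi2|apply: integZ; exact: mo_int].
have I2 : integ y t (fun u => phi u ^+ 2 + 2 * s * c2 * ro u).
  by apply: integD; [apply: integS phi2|apply: integZ; apply: ro_int]; rewrite // ltW.
have I3 : integ 0 y (fun u => phi u ^+ 2) by exact: integS phi2.
have I23 : integ y rho B.
  by apply: (@integ_cat _ _ t) => //; [exact: ltW|exact: integ_eq B2 I2|exact: integ_eq B1 I1].
have IB : integ 0 rho B by apply: (@integ_cat _ _ y) => //; exact: integ_eq B3 I3.
have gB u : 0 < u <= rho -> g u ^+ 2 <= B u.
  move=> /andP[u0 ur]; have [uy|yu] := leP u y.
    by rewrite -B3 ?u0// g_rest ?u0.
  have [ut|tu] := leP u t.
    rewrite -B2 ?yu// g_fill ?yu//.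
    have /(@excess_removed_sqr _ (- s) c2 phi u) : - s = 1 \/ - s = -1.
      by case: hs => ->; rewrite ?opprK; [right|left].
    by rewrite -/ro; lra.
  rewrite -B1 ?tu// g_window ?tu//.
  have := @excess_removed_sqr _ s c1 phi u hs.
  by rewrite -/mo; lra.
have Ig : integ 0 rho (fun u => g u ^+ 2).
  apply: (integ_le _ _ IB); last first.
    by move=> u u0; rewrite ger0_norm ?sqr_ge0// gB.
  by apply: measurable_funX; exact: integ_measurable transfer_integ.
split=> //; apply: le_trans (Iint_le Ig IB gB) _.
rewrite (@Iint_cat _ y 0 rho B)// (@Iint_cat _ t y rho B)//; last exact: ltW.
rewrite -(Iint_eq B1) -(Iint_eq B2) -(Iint_eq B3).
rewrite (@Iint_cat _ y 0 rho (fun u => phi u ^+ 2))//.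
rewrite (@Iint_cat _ t y rho (fun u => phi u ^+ 2))//; [|exact: ltW|exact: integS phi2].
rewrite Iint_D; [|by apply: integS phi2; rewrite // ltW|].
  2: by apply: integZ; apply: ro_int; rewrite // ltW.
rewrite Iint_D; [|exact: integS phi2|by apply: integZ; exact: mo_int].
rewrite !Iint_Z; [|by apply: mo_int|by apply: ro_int; rewrite // ltW].
by rewrite yE -/m; lra.
Qed.

End mass_transfer.

(** * Masses near a left Lebesgue point *)

Section lebesgue_window.
Context {R : realType}.
Variables (s rho t l d : R) (phi : R -> R).
(* Going from [l] to [c] the levels l, c2, c1, c increase in steps of [d] when
   [s = 1] and decrease when [s = -1]. *)
Let c := l + 3 * s * d.
Let c1 := l + 2 * s * d.
Let c2 := l + s * d.
Hypotheses (hs : s = 1 \/ s = -1) (t0 : 0 <= t) (trho : t < rho) (d0 : 0 < d).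
Hypothesis phi_int : integ 0 rho phi.
Hypothesis near_c : forall x, t <= x -> x < rho ->
  Iint x rho (fun u => `|phi u - c|) <= d / 2 * (rho - x).

Let phi_sub (a b : R) : 0 <= a -> b <= rho -> integ a b phi.
Proof. by move=> a0 br; exact: integS phi_int. Qed.

Let dist_int (a b : R) : 0 <= a -> b <= rho -> integ a b (fun u => `|phi u - c|).
Proof. by move=> *; apply: integ_norm; apply: integB; [exact: phi_sub|exact: integ_cst]. Qed.

(** The mean over []x, rho]] is within [d / 2] of [c], which lies [3 * d] from [l]. *)
Let Iint_near (x : R) : t <= x -> x < rho ->
  (l * s + 5 / 2 * d) * (rho - x) <= s * Iint x rho phi.
Proof.
move=> tx xr; have x0 : 0 <= x by exact: le_trans tx.
have near := near_c tx xr.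
have : Iint x rho (fun u => s * c - `|phi u - c|) <= Iint x rho (fun u => s * phi u).
  apply: Iint_le.
  - by apply: integB; [exact: integ_cst|exact: dist_int].
  - by apply: integZ; exact: phi_sub.
  - move=> u _; have := ler_norm (phi u - c); have := ler_norm (- (phi u - c)).
    by rewrite normrN; case: hs => ->; lra.
rewrite Iint_Z; last exact: phi_sub.
rewrite Iint_cstB ?(ltW xr)//; last exact: dist_int.
rewrite (_ : s * c = l * s + 3 * d); last by rewrite /c; case: hs => ->; lra.
by lra.
Qed.

(** [c1] lies [2 * d] from [l], so by [Iint_near] the mean of [s * (phi - c1)] is at least
    [d / 2]. *)
Lemma window_mass_gt0 : 0 < Iint t rho (excess s c1 phi).
Proof.
have : Iint t rho (fun u => s * (phi u - c1)) <= Iint t rho (excess s c1 phi).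
  apply: Iint_le; last by move=> u _; exact: excess_ge.
  - by apply: integZ; apply: integB; [exact: phi_sub|exact: integ_cst].
  - by apply: integ_excess; exact: phi_sub.
apply: lt_le_trans; rewrite Iint_Z; last first.
  by apply: integB; [exact: phi_sub|exact: integ_cst].
rewrite Iint_Bcst ?(ltW trho)//; last exact: phi_sub.
have := Iint_near (lexx t) trho.
have : 0 < d * (rho - t) by rewrite mulr_gt0// subr_gt0.
by rewrite /c1; case: hs => ->; lra.
Qed.

(** The excess over [c1] is at most the gap [d] between [c1] and [c] plus the distance of [phi] to
    [c], whose mean is at most [d / 2]. *)
Lemma window_mass_le : Iint t rho (excess s c1 phi) <= 3 / 2 * d * (rho - t).
Proof.
have near := near_c (lexx t) trho.
have : Iint t rho (excess s c1 phi) <= Iint t rho (fun u => d + `|phi u - c|).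
  apply: Iint_le.
  - by apply: integ_excess; exact: phi_sub.
  - by apply: integD; [exact: integ_cst|exact: dist_int].
  - move=> u _; rewrite /excess ge_max; apply/andP; split.
      have := ler_norm (phi u - c); have := ler_norm (- (phi u - c)).
      by rewrite normrN /c1 /c; case: hs => ->; lra.
    by rewrite addr_ge0// ltW.
by rewrite Iint_cstD ?(ltW trho)//; [lra|exact: dist_int].
Qed.

(** Say [s = 1]: the mean over []eta, rho]] is at most [l], but over []t, rho]] at least
    [l + 5 / 2 * d]. So [eta < t], and the mass on []eta, t]] falls short of [l * (t - eta)] by at
    least [5 / 2 * d * (rho - t)]. This room below [c2 > l] exceeds the bound of
    [window_mass_le]. *)
Lemma window_capacity (eta : R) : 0 <= eta -> eta < rho ->
  s * (Iint eta rho phi - l * (rho - eta)) <= 0 ->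
  Iint t rho (excess s c1 phi) <= Iint 0 t (excess (- s) c2 phi).
Proof.
move=> eta0 etar heta; have etat : eta < t.
  rewrite ltNge; apply/negP => teta; have := Iint_near teta etar.
  have : 0 < d * (rho - eta) by rewrite mulr_gt0// subr_gt0.
  by move: heta; rewrite mulrBr; lra.
apply: (le_trans window_mass_le).
have tr := ltW trho.
have ex_int (a : R) : 0 <= a -> integ a t (excess (- s) c2 phi).
  by move=> a0; apply: integ_excess; exact: phi_sub.
apply: (@le_trans _ _ (Iint eta t (excess (- s) c2 phi))); last first.
  by apply: Iint_leS => //; [exact: ltW|exact: ex_int|move=> *; exact: excess_ge0].
have : Iint eta t (fun u => - s * (phi u - c2)) <= Iint eta t (excess (- s) c2 phi).
  apply: Iint_le; last by move=> u _; exact: excess_ge.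
  - by apply: integZ; apply: integB; [exact: phi_sub|exact: integ_cst].
  - exact: ex_int.
apply: le_trans; rewrite Iint_Z; last first.
  by apply: integB; [exact: phi_sub|exact: integ_cst].
rewrite Iint_Bcst ?(ltW etat)//; last exact: phi_sub.
move: heta; rewrite (@Iint_cat _ t eta rho)//; [|exact: ltW|exact: phi_sub].
have := Iint_near (lexx t) trho.
have : 0 < d * (rho - t) by rewrite mulr_gt0// subr_gt0.
have : 0 < d * (t - eta) by rewrite mulr_gt0// subr_gt0.
by rewrite /c2; case: hs => ->; lra.
Qed.

(** For [s = -1] mass is added before it is taken back, so tails can rise. On the window [g] is at
    most [c1] plus the distance of [phi] to [c], with mean at most [c1 + d / 2 < c2]; on []y, t]] it
    is clipped to at most [c2]; below [y] the transfer is balanced. *)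
Lemma transfer_advanced (y : R) (g : R -> R) (x : R) :
  mass_transfer s rho t y c1 c2 phi g -> s = -1 -> 0 <= x -> x <= rho ->
  Iint x rho g <= Iint x rho phi \/ Iint x rho g <= c2 * (rho - x).
Proof.
move=> tr s1 x0 xr.
have g_int (a b : R) : 0 <= a -> b <= rho -> integ a b g.
  by move=> a0 br; apply: integS (transfer_integ tr phi_int).
have advanced_window (z : R) : t <= z -> z <= rho -> Iint z rho g <= c2 * (rho - z).
  move=> tz; rewrite le_eqVlt => /predU1P[->|zr]; first by rewrite Iint_nil subrr mulr0.
  have z0 : 0 <= z by exact: le_trans tz.
  have near := near_c tz zr.
  have : Iint z rho g <= Iint z rho (fun u => c1 + `|phi u - c|).
    apply: Iint_le; first exact: g_int.
    - by apply: integD; [exact: integ_cst|exact: dist_int].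
    - move=> u /andP[zu ur]; rewrite (transfer_window tr) ?ur ?(le_lt_trans tz zu)//.
      have /= := @excess_removeP _ s c1 phi u hs.
      have := ler_norm (phi u - c); have := normr_ge0 (phi u - c).
      by rewrite /c1 /c s1; have := d0 => d0' h1 h2 [] [h3 h4]; lra.
  rewrite Iint_cstD ?(ltW zr)//; last exact: dist_int.
  have : 0 < d * (rho - z) by rewrite mulr_gt0// subr_gt0.
  by rewrite /c1 /c2 s1; lra.
have [tx|/ltW xt] := leP t x; first by right; exact: advanced_window.
have [yx|xy] := leP y x.
  right; rewrite (@Iint_cat _ t x)//; [|exact: ltW|exact: g_int].
  have := advanced_window _ (lexx t) (ltW trho).
  have : Iint x t g <= Iint x t (fun=> c2).
    apply: Iint_le; [by apply: g_int; rewrite // ltW|exact: integ_cst|].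
    move=> u /andP[xu ut]; rewrite (transfer_fill tr) ?ut ?(le_lt_trans yx xu)//.
    have hs' : - s = 1 \/ - s = -1 by rewrite s1 opprK; left.
    have /= := @excess_removeP _ (- s) c2 phi u hs'.
    have := excess_ge0 (- s) c2 phi u; have := excess_ge (- s) c2 phi u.
    by rewrite s1 => h1 h2 [] [h3 h4]; lra.
  by rewrite Iint_cst//; lra.
left; have [yE|yE] := eqVneq (Iint y t (excess (- s) c2 phi)) (Iint t rho (excess s c1 phi)).
  by rewrite (transfer_balanced tr phi_int)// ltW.
suff y0 : y = 0 by move: xy; rewrite y0 ltNge x0.
by apply: (transfer_fill_end tr); rewrite lt_neqAle yE (transfer_fill_le tr).
Qed.

End lebesgue_window.

(** * Partially specified estimators *)

Lemma ae_itv_le (R : realType) (a b : R) :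
  {ae @completed_lebesgue_measure R, forall u : R, a < u <= b -> False} -> b <= a.
Proof.
move=> [A [mA A0 sA]]; rewrite leNgt; apply/negP => ab.
have : (@completed_lebesgue_measure R `]a, b] <= @completed_lebesgue_measure R A)%E.
  apply: le_measure; rewrite ?inE//; first exact: cmeasurable_itv.
  by move=> u uab; apply: sA => /=; apply; move: uab; rewrite /= in_itv.
move=> le1; have le2 : (@completed_lebesgue_measure R A <= 0%:E)%E by rewrite A0.
have := le_trans le1 le2; have -> := mu_itvoc (ltW ab); rewrite lee_fin.
by rewrite subr_le0 leNgt ab.
Qed.

Section estimators.
Context {R : realType} {V : Type} (S : monotone_sampling R V) (f : V -> R).
Hypothesis f_ge0 : forall v, 0 <= f v.
Local Notation mu := (@completed_lebesgue_measure R).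
Implicit Types (e : pestimator S) (u x : R) (v w z : V).

Lemma sample_up u x w z : 0 < u -> u <= x -> x <= 1 ->
  sample S u z = sample S u w -> sample S x z = sample S x w.
Proof.
move=> u0 ux x1 uzw.
have u01 : 0 < u <= 1 by rewrite u0 (le_trans ux).
have x01 : 0 < x <= 1 by rewrite (lt_le_trans u0).
apply/(Sstar_consistent _ _ _ x01)/(Sstar_mono u0 ux x1).
exact/(Sstar_consistent _ _ _ u01).
Qed.

Lemma est_sample e u w z : sample S u z = sample S u w -> est e u z = est e u w.
Proof. by move=> zw; rewrite /est zw. Qed.

Lemma threshold_le e w r a : threshold e w r -> 0 <= a ->
  {ae mu, forall u : R, a < u <= 1 -> specified e u w} -> r <= a.
Proof.
move=> [/andP[r0 r1] _ unspec] a0 spec; apply: ae_itv_le.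
apply: ae_imp (ae_and spec unspec) => u [h1 h2] /andP[au ur].
have := h2; rewrite in_itv/= ur (le_lt_trans a0 au) => /(_ isT).
by rewrite h1// au (le_trans ur).
Qed.

Lemma threshold_ge e w r a b : threshold e w r -> a < b -> 0 <= a -> b <= 1 ->
  {ae mu, forall u : R, a < u <= b -> ~~ specified e u w} -> b <= r.
Proof.
move=> [/andP[r0 r1] spec _] ab a0 b1 unspec.
have [//|rb] := leP b r.
suff : b <= Num.max a r by rewrite le_max !leNgt ab rb.
apply: ae_itv_le; apply: ae_imp (ae_and spec unspec) => u [h1 h2] /andP[].
rewrite gt_max => /andP[au ru] ub.
have := h1; rewrite in_itv/= ru (le_trans ub b1) => /(_ isT).
by apply/negP/h2; rewrite au.
Qed.

Section lower_bound.

Let has_inf_image u w : 0 < u <= 1 -> has_inf (f @` Sstar S u w).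
Proof.
move=> u01; split; first by exists (f w), w => //; exact: Sstar_refl.
by exists 0 => _ [z _ <-].
Qed.

Lemma lower_bound_sample u w z : 0 < u <= 1 -> sample S u z = sample S u w ->
  lower_bound S f u z = lower_bound S f u w.
Proof.
move=> u01 /(Sstar_consistent _ _ _ u01) zw.
by rewrite /lower_bound (Sstar_eq u01 zw).
Qed.

Lemma lower_bound_le u w z : 0 < u <= 1 -> sample S u z = sample S u w ->
  lower_bound S f u w <= f z.
Proof.
move=> u01 /(Sstar_consistent _ _ _ u01) zw.
by apply: ge_inf; [exact: (has_inf_image w u01).2|exists z].
Qed.

Lemma le_lower_bound u w (k : R) : 0 < u <= 1 ->
  (forall z, sample S u z = sample S u w -> k <= f z) -> k <= lower_bound S f u w.
Proof.
move=> u01 kf; apply: lb_le_inf; first exact: (has_inf_image w u01).1.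
by move=> _ [z zw <-]; apply: kf; exact/(Sstar_consistent _ _ _ u01).
Qed.

Lemma lower_bound_nonincreasing u x w : 0 < u -> u <= x -> x <= 1 ->
  lower_bound S f x w <= lower_bound S f u w.
Proof.
move=> u0 ux x1; apply: le_lower_bound; first by rewrite u0 (le_trans ux).
move=> z uzw; apply: lower_bound_le; first by rewrite (lt_le_trans u0).
exact: sample_up uzw.
Qed.

(** The lower bound is monotone and bounded by [f w], so the limit at [0] exists and is its supremum
    over []0, 1]]. *)
Lemma lower_bound_le0 u w : 0 < u <= 1 -> lower_bound S f u w <= lower_bound0 S f 0 w.
Proof.
move=> u01; rewrite /lower_bound0 eqxx.
have ub : has_ubound [set lower_bound S f x w | x in [set` `]0, 1]]].
  exists (f w) => _ [x x01 <-]; move: x01; rewrite /= in_itv/= => x01.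
  exact (lower_bound_le x01 erefl).
rewrite (cvg_lim _ (nonincreasing_at_right_cvgr _ _ ub))//.
- by apply: ub_le_sup => //; exists u => //=; rewrite in_itv.
- by rewrite bnd_simp.
- move=> x x' /= ; rewrite !in_itv/= => /andP[x0 x1] /andP[x'0 x'1] xx'.
  exact: lower_bound_nonincreasing.
Qed.

End lower_bound.

Section partial_estimator.
Variables (e : pestimator S) (r : V -> R).
Hypothesis per : partial_estimator f e r.

Lemma est_ge0 u w : 0 <= est e u w.
Proof. by rewrite /est; case E: (e _) => [k|]//=; exact: per.1 E. Qed.

Lemma partial_threshold w : threshold e w (r w).
Proof. by case: (per.2 w). Qed.

Lemma partial_integ w : integ 0 1 (est e ^~ w).
Proof.
case: (per.2 w) => [[/andP[r0 r1] _ unspec] I _ _].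
apply: (@integ_cat _ _ (r w)) => //.
have : {ae mu, forall u : R, 0 < u <= r w -> 0 = est e u w}.
  apply: ae_imp unspec => u; rewrite in_itv/= => h /h.
  by rewrite /specified /est; case: (e _).
by move=> /ae_Iint/(_ (integ_cst 0 (r w) 0))[].
Qed.

Lemma partial_integS (a b : R) w : 0 <= a -> b <= 1 -> integ a b (est e ^~ w).
Proof. by move=> a0 b1; exact: integS (partial_integ w). Qed.

Lemma tail_integralE (a : R) w : 0 <= a ->
  tail_integral e a w = (Iint a 1 (est e ^~ w))%:E.
Proof. by move=> a0; rewrite -Iint_EFin//; exact: partial_integS. Qed.

Lemma partial_le w : Iint (r w) 1 (est e ^~ w) <= f w.
Proof.
case: (per.2 w) => [[/andP[r0 r1] _ _] _ le1 eq1].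
rewrite -lee_fin -tail_integralE//.
by move: r0; rewrite le_eqVlt => /predU1P[r0|/le1//]; rewrite -r0 eq1.
Qed.

Lemma partial_eq w : r w = 0 -> Iint 0 1 (est e ^~ w) = f w.
Proof.
by case: (per.2 w) => _ _ _ eq1 /eq1; rewrite tail_integralE// => -[->].
Qed.

(** Any [z] consistent with [w] at [x] has the same estimates above [x], and since estimates are
    nonnegative their integral there is at most [f z]. The infimum over [z] gives the claim. *)
Lemma Iint_le_lower_bound (x : R) w : 0 < x <= 1 -> r w <= x ->
  Iint x 1 (est e ^~ w) <= lower_bound S f x w.
Proof.
move=> x01 rx; have /andP[x0 x1] := x01.
apply: le_lower_bound => // z zw.
have zwu u : x < u <= 1 -> sample S u z = sample S u w.
  by move=> /andP[xu u1]; apply: (sample_up x0 _ u1 zw); exact: ltW.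
have rzx : r z <= x.
  apply: (threshold_le (partial_threshold z)); first exact: ltW.
  case: (partial_threshold w) => _ spec _.
  apply: ae_imp spec => u h xu1; rewrite /specified zwu//; apply: h.
  by case/andP: xu1 => xu u1; rewrite in_itv/= (le_lt_trans rx xu).
rewrite (@Iint_eq _ _ _ (est e ^~ w) (est e ^~ z)); last first.
  by move=> u /zwu/est_sample ->.
apply: le_trans (partial_le z); case: (partial_threshold z) => /andP[rz0 _] _ _.
by apply: Iint_leS => //; [exact: partial_integS|move=> *; exact: est_ge0].
Qed.

Lemma lambda_lt v z (x l : R) : 0 < x <= 1 ->
  (lambda f e v x z < l%:E)%E -> exists2 eta : R, 0 <= eta < x &
    lower_bound0 S f eta z - Iint x 1 (est e ^~ v) < l * (x - eta).
Proof.
move=> /andP[x0 x1] /ereal_inf_lt[_ [eta etax <-]]; move: etax; rewrite /= in_itv/= => etax.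
have xeta : 0 < x - eta by case/andP: etax => _; rewrite subr_gt0.
rewrite (tail_integralE _ (ltW x0)) -EFinB -EFinM lte_fin ltr_pdivrMr// => h.
by exists eta.
Qed.

Lemma lambda_ge v z (x l eta : R) : 0 < x <= 1 ->
  (l%:E <= lambda f e v x z)%E -> 0 < eta < x ->
  l * (x - eta) <= lower_bound S f eta z - Iint x 1 (est e ^~ v).
Proof.
move=> /andP[x0 x1] llam /andP[eta0 etax].
have xeta : 0 < x - eta by rewrite subr_gt0.
rewrite -ler_pdivlMr// -lee_fin; apply: le_trans llam _.
apply: ereal_inf_lbound; exists eta => /=; first by rewrite in_itv/= (ltW eta0).
by rewrite (tail_integralE _ (ltW x0)) -EFinB -EFinM /lower_bound0 gt_eqF.
Qed.

(** The lower bound only grows as the seed decreases from [x], and at [x] it already dominates the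
    tail integral. *)
Lemma lambda_ge0 v (x : R) : r v = 0 -> 0 < x <= 1 -> (0 <= lambda f e v x v)%E.
Proof.
move=> rv0 x01; have /andP[x0 x1] := x01.
apply: le_ereal_inf_tmp => _ [eta etax <-]; move: etax; rewrite /= in_itv/= => /andP[eta0 etax].
rewrite (tail_integralE _ (ltW x0)) -EFinB -EFinM lee_fin.
apply: divr_ge0; last by rewrite subr_ge0 ltW.
rewrite subr_ge0; apply: le_trans (Iint_le_lower_bound x01 _) _; first by rewrite rv0 ltW.
rewrite /lower_bound0; case: eqVneq => [_|etan0].
  by have := lower_bound_le0 v x01; rewrite /lower_bound0 eqxx.
by apply: lower_bound_nonincreasing => //; [rewrite lt_neqAle eq_sym etan0|exact: ltW].
Qed.

End partial_estimator.

End estimators.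

(** * From bounds on [lambda] over [Z] to bounds on estimates and values *)

Section slope.
Context {R : realType} {V : Type} (S : monotone_sampling R V) (f : V -> R).
Hypothesis f_ge0 : forall v, 0 <= f v.
Variables (e : pestimator S) (r : V -> R) (Z : set V) (v : V) (rho L : R).
Hypotheses (per : partial_estimator f e r) (rho01 : 0 < rho <= 1).
Let M := Iint rho 1 (est e ^~ v).
(** Control by [lambda] passes from [Z] to a vector [w] outside [Z] as long as each outcome of [w]
    above [a] is shared with some vector of [Z], possibly a different one at each seed. *)
Let tip (w : V) (a : R) :=
  forall u, a < u <= 1 -> exists2 z, Z z & sample S u z = sample S u w.

Lemma Iint_tail_sample (w : V) : sample S rho w = sample S rho v ->
  Iint rho 1 (est e ^~ w) = M.
Proof.
move=> wv; apply: Iint_eq => u /andP[ru u1]; apply: est_sample.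
by case/andP: rho01 => rho0 _; apply: (sample_up rho0 (ltW ru) u1).
Qed.

(** A [z] in [Z] sharing the outcome of [w] at a small seed [x] has a good [eta] by the bound on
    [lambda]. This [eta] depends on [z] and may lie below [x], where [z] and [w] can differ; the gap
    between [L] and [l] pays for moving it up to [x]. [Iint_le_lower_bound] then turns the lower
    bound into one on the estimates of [w]. *)
Lemma slope_below (l : R) (w : V) : 0 <= L -> L < l ->
  (forall z, Z z -> sample S rho z = sample S rho v ->
    (lambda f e v rho z < L%:E)%E) ->
  sample S rho w = sample S rho v -> r w = 0 -> tip w 0 ->
  exists eta : R, 0 <= eta < rho /\ Iint eta rho (est e ^~ w) <= l * (rho - eta).
Proof.
move=> L0 Ll lam wv rw0 Zw; have /andP[rho0 rho1] := rho01.
suff [x /andP[x0 xr] lbx] : exists2 x, 0 < x < rho &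
    lower_bound S f x w - M <= l * (rho - x).
  exists x; split; first by rewrite ltW.
  have x01 : 0 < x <= 1 by rewrite x0 (le_trans (ltW xr)).
  have := Iint_le_lower_bound f_ge0 per x01; move=> /(_ w).
  rewrite rw0 (ltW x0) => /(_ isT); rewrite (@Iint_cat _ rho x 1)//; last 2 first.
  - exact: ltW.
  - by apply: (partial_integS per) => //; exact: ltW.
  by rewrite Iint_tail_sample//; lra.
have l0 : 0 < l by exact: le_lt_trans Ll.
(* Chosen so that [l * (rho - x)] is [rho * (l + L) / 2], hence at least [L * rho]. *)
pose x := rho * ((l - L) / (2 * l)).
have k0 : 0 < (l - L) / (2 * l) by rewrite divr_gt0 ?subr_gt0 ?mulr_gt0.
have k1 : (l - L) / (2 * l) < 1 by rewrite ltr_pdivrMr ?mulr_gt0//; lra.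
have x0 : 0 < x by rewrite mulr_gt0.
have xr : x < rho by rewrite /x gtr_pMr.
have Lx : L * rho <= l * (rho - x).
  have -> : l * (rho - x) = rho * (l - l * ((l - L) / (2 * l))) by rewrite /x; lra.
  have -> : l * ((l - L) / (2 * l)) = (l - L) / 2.
    by field; rewrite gt_eqF.
  rewrite mulrC ler_pM2l//; lra.
have x1 : x <= 1 by rewrite (le_trans (ltW xr)).
have [|z Zz zw] := Zw x; first by rewrite x0.
have x01 : 0 < x <= 1 by rewrite x0.
have zv : sample S rho z = sample S rho v.
  by rewrite -wv; apply: (sample_up x0 (ltW xr) rho1 zw).
have [eta /andP[eta0 etar] lbeta] := lambda_lt per rho01 (lam z Zz zv).
have [xeta|etax] := leP x eta.
  have eta0' : 0 < eta by exact: lt_le_trans xeta.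
  have eta1 : eta <= 1 by rewrite (le_trans (ltW etar)).
  exists eta; first by rewrite eta0'.
  have Ll' : L * (rho - eta) <= l * (rho - eta) by rewrite ler_pM2r ?ltW// subr_gt0.
  move: lbeta; rewrite /lower_bound0 gt_eqF// -/M.
  rewrite (@lower_bound_sample _ _ _ f eta w z) ?eta0'//; first lra.
  exact: sample_up zw.
exists x; first by rewrite x0.
have lbx : lower_bound S f x w <= lower_bound0 S f eta z.
  rewrite -(lower_bound_sample f x01 zw).
  have [->|etan0] := eqVneq eta 0; first exact: lower_bound_le0.
  rewrite /lower_bound0 (negPf etan0); apply: lower_bound_nonincreasing => //.
  - by rewrite lt_neqAle eq_sym etan0.
  - exact: ltW.
have : L * eta >= 0 by rewrite mulr_ge0.
by move: lbeta; rewrite -/M; lra.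
Qed.

(** For each [u] in []a, rho[] some [z] in [Z] shares the outcome of [w] at [u], so its lower bound
    there is at most [f w]. Then [u] tends to [a]. *)
Lemma slope_above (a : R) (w : V) : 0 < L -> 0 <= a -> a < rho ->
  (forall z, Z z -> sample S rho z = sample S rho v ->
    (L%:E <= lambda f e v rho z)%E) ->
  sample S rho w = sample S rho v -> tip w a ->
  L * (rho - a) + M <= f w.
Proof.
move=> L0 a0 ar lam wv Zw; have /andP[rho0 rho1] := rho01.
have lbf u : a < u < rho -> L * (rho - u) + M <= f w.
  move=> /andP[au ur]; have u0 : 0 < u by exact: le_lt_trans au.
  have u1 : u <= 1 by rewrite (le_trans (ltW ur)).
  have [|z Zz zw] := Zw u; first by rewrite au.
  have zv : sample S rho z = sample S rho v.
    by rewrite -wv; apply: (sample_up u0 (ltW ur) rho1 zw).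
  have : lower_bound S f u z <= f w by apply: lower_bound_le; rewrite ?u0.
  have := lambda_ge per rho01 (lam z Zz zv); move=> /(_ u).
  by rewrite u0 ur -/M => /(_ isT); lra.
rewrite leNgt; apply/negP => fw.
(* Moving [u] up from [a] by [k] costs [L * k], half of the supposed deficit. *)
pose k := (L * (rho - a) + M - f w) / (2 * L).
have k0 : 0 < k by rewrite divr_gt0 ?subr_gt0 ?mulr_gt0.
pose u := Num.min (a + k) ((a + rho) / 2).
have au : a < u by rewrite lt_min ltrDl k0/=; lra.
have ur : u < rho by rewrite gt_min; apply/orP; right; lra.
have uk : u <= a + k by rewrite ge_min lexx.
have : L * u <= L * (a + k) by rewrite ler_pM2l.
have -> : L * (a + k) = L * a + (L * (rho - a) + M - f w) / 2.
  by rewrite /k; field; rewrite gt_eqF.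
by have := lbf u; rewrite au ur => /(_ isT); lra.
Qed.

End slope.

(** * The revised estimator *)

Section revision.
Context {R : realType} {V : Type} (S : monotone_sampling R V).
Variables (e : pestimator S) (v : V) (s rho h c1 c2 : R).
Hypothesis rho01 : 0 < rho <= 1.
Hypotheses (h0 : 0 < h) (hrho : h <= rho).
Hypotheses (hs : s = 1 \/ s = -1) (c1_ge0 : 0 <= c1) (c2_ge0 : 0 <= c2).
Hypothesis e_ge0 : forall u w, 0 <= est e u w.
Hypothesis e_int : forall w, integ 0 1 (est e ^~ w).

Definition window (w : V) (u : R) : bool :=
  `[< rho - h < u <= rho /\ sample S u w = sample S u v >].

Definition removal w u := if window w u then excess s c1 (est e ^~ w) u else 0.
Definition room w u := if window w u then 0 else excess (- s) c2 (est e ^~ w) u.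

(** Pouring continues while the room met so far, going down from [rho], is less than the mass
    removed. Both integrals see only seeds above [u], where outcomes are determined by the outcome
    at [u]; hence [revised_sample]. *)
Definition revised w u := est e u w - s * removal w u +
  (if Iint u rho (room w) < Iint u rho (removal w) then s * room w u else 0).

Lemma revised_ge0 w u : 0 <= revised w u.
Proof.
have hs' : - s = 1 \/ - s = -1 by case: hs => ->; rewrite ?opprK; [right|left].
rewrite /revised /removal /room; case: (window w u).
  rewrite mulr0 if_same addr0.
  exact: (@excess_removed_ge0 _ s c1 (est e ^~ w) u).
rewrite mulr0 subr0; case: ifP => _; last by rewrite addr0.
have := @excess_removed_ge0 _ (- s) c2 (est e ^~ w) u hs' c2_ge0 (e_ge0 u w).
by rewrite mulNr opprK.
Qed.

Lemma revised_sample u w z : 0 < u -> u <= rho -> sample S u z = sample S u w ->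
  revised z u = revised w u.
Proof.
move=> u0 ur zw; have /andP[_ rho1] := rho01.
have eq_up x : u <= x <= rho -> [/\ est e x z = est e x w, window z x = window w x,
    excess s c1 (est e ^~ z) x = excess s c1 (est e ^~ w) x &
    excess (- s) c2 (est e ^~ z) x = excess (- s) c2 (est e ^~ w) x].
  move=> /andP[ux xr]; have zwx := sample_up u0 ux (le_trans xr rho1) zw.
  by rewrite /window /excess /est zwx.
have eq_itv x : u < x <= rho -> room z x = room w x /\ removal z x = removal w x.
  move=> /andP[ux xr]; have [|h1 h2 h3 h4] := eq_up x; first by rewrite ltW.
  by rewrite /room /removal h2 h3 h4.
have [|h1 h2 h3 h4] := eq_up u; first by rewrite lexx.
rewrite /revised (@Iint_eq _ _ _ (room z) (room w)); last by move=> x /eq_itv[].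
rewrite (@Iint_eq _ _ _ (removal z) (removal w)); last by move=> x /eq_itv[].
by rewrite /removal /room h1 h2 h3 h4.
Qed.

(** Monotonicity of the scheme makes the set of window seeds an interval ending at [rho]. By
    [Sstar_open] agreement with [v] extends slightly below each of its points, so its infimum [t] is
    excluded. *)
Lemma window_start w : sample S rho w = sample S rho v ->
  exists2 t, rho - h <= t < rho & forall u, 0 < u <= rho -> window w u = (t < u).
Proof.
move=> wv; have /andP[rho0 rho1] := rho01.
pose A := [set u | rho - h < u <= rho /\ sample S u w = sample S u v].
have rhA : A rho by split; rewrite // lexx andbT gtrBl.
have infA : has_inf A.
  by split; [exists rho|exists (rho - h) => u [/andP[/ltW]]].
pose t := inf A.
have ht : rho - h <= t by apply: lb_le_inf; [exists rho|move=> u [/andP[/ltW]]].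
have At u : A u -> t < u.
  move=> [/andP[hu ur] uwv]; have u0 : 0 < u by apply: le_lt_trans hu; rewrite subr_ge0.
  have u01 : 0 < u <= 1 by rewrite u0 (le_trans ur).
  have [d d0 dP] := Sstar_open u01 ((Sstar_consistent _ _ _ u01).2 uwv).
  pose x := Num.max (u - d / 2) ((rho - h + u) / 2).
  have xu : x < u by rewrite gt_max; apply/andP; split; lra.
  have hx : rho - h < x by rewrite lt_max; apply/orP; right; lra.
  have x0 : 0 < x by apply: le_lt_trans hx; rewrite subr_ge0.
  have x01 : 0 < x <= 1 by rewrite x0 (le_trans (ltW xu)) ?(le_trans ur).
  apply: (le_lt_trans _ xu); apply: (ge_inf infA.2); split.
    by rewrite hx (le_trans (ltW xu)).
  apply/(Sstar_consistent _ _ _ x01)/dP => //.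
  by rewrite lt_max; apply/orP; left; lra.
exists t; first by rewrite ht At.
move=> u /andP[u0 ur]; apply/asboolP/idP; first exact: At.
move=> tu; have [|x [/andP[hx xr] xwv] xu] := @inf_lt _ A u _ tu; first by exists rho.
have x0 : 0 < x by apply: le_lt_trans hx; rewrite subr_ge0.
split; first by rewrite ur (lt_trans hx).
exact: (sample_up x0 (ltW xu) (le_trans ur rho1) xwv).
Qed.

Lemma revised_transfer w : sample S rho w = sample S rho v ->
  exists t y, [/\ rho - h <= t, forall u, t < u <= rho -> sample S u w = sample S u v &
    mass_transfer s rho t y c1 c2 (est e ^~ w) (revised w)].
Proof.
move=> wv; have /andP[rho0 rho1] := rho01.
have [t /andP[ht tr] winE] := window_start wv.
have t0 : 0 <= t by apply: le_trans ht; rewrite subr_ge0.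
have e_intS (a b : R) : 0 <= a -> b <= 1 -> integ a b (est e ^~ w).
  by move=> a0 b1; exact: integS (e_int w).
have t1 : t <= 1 by rewrite (le_trans (ltW tr)).
pose m := Iint t rho (excess s c1 (est e ^~ w)).
have m0 : 0 <= m by apply: Iint_ge0 => *; exact: excess_ge0.
have room_int : integ 0 t (excess (- s) c2 (est e ^~ w)).
  by apply: integ_excess; exact: e_intS.
have [y [/andP[y0 yt] below above fill_le fill_end]] :=
  level_cut t0 m0 room_int (fun u _ => excess_ge0 _ _ _ _).
(* Below the window the removed mass has reached its total [m], and room accumulates only on []u,
   t]]; the test in [revised] therefore becomes the comparison of [u] with [y]. *)
have past (u : R) : 0 < u -> u <= t ->
    Iint u rho (room w) = Iint u t (excess (- s) c2 (est e ^~ w)) /\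
    Iint u rho (removal w) = m.
  move=> u0 ut; have u0' := ltW u0.
  have roomt : forall x, u < x <= t -> excess (- s) c2 (est e ^~ w) x = room w x.
    move=> x /andP[ux xt]; rewrite /room winE ?(lt_trans u0 ux) ?(le_trans xt (ltW tr))//.
    by rewrite ltNge xt.
  have roomr : forall x, t < x <= rho -> 0 = room w x.
    by move=> x /andP[tx xr]; rewrite /room winE ?xr ?(le_lt_trans t0 tx)// tx.
  have remt : forall x, u < x <= t -> 0 = removal w x.
    move=> x /andP[ux xt]; rewrite /removal winE ?(lt_trans u0 ux) ?(le_trans xt (ltW tr))//.
    by rewrite ltNge xt.
  have remr : forall x, t < x <= rho -> excess s c1 (est e ^~ w) x = removal w x.
    by move=> x /andP[tx xr]; rewrite /removal winE ?xr ?(le_lt_trans t0 tx)// tx.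
  have I1 : integ u t (room w).
    by apply: integ_eq roomt _; exact: integS room_int.
  have I2 := integ_eq roomr (integ_cst t rho 0).
  have I3 := integ_eq remt (integ_cst u t 0).
  have I4 : integ t rho (removal w).
    by apply: integ_eq remr _; apply: integ_excess; exact: e_intS.
  have tr' := ltW tr.
  rewrite (@Iint_cat _ t u rho (room w))//; last exact: integ_cat I1 I2.
  rewrite (@Iint_cat _ t u rho (removal w))//; last exact: integ_cat I3 I4.
  rewrite -(Iint_eq roomt) -(Iint_eq roomr) -(Iint_eq remt) -(Iint_eq remr).
  by rewrite !Iint_cst// !mul0r addr0 add0r.
exists t, y; split=> //.
  move=> u /andP[tu ur]; have := winE u; rewrite ur tu (le_lt_trans t0 tu).
  by move=> /(_ isT)/asboolP[].
split=> //.
- move=> u /andP[tu ur]; have u0 : 0 < u by exact: le_lt_trans tu.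
  by rewrite /revised /removal /room winE ?u0// tu mulr0 if_same addr0.
- move=> u /andP[yu ut]; have u0 : 0 < u by exact: le_lt_trans yu.
  have ur : u <= rho by rewrite (le_trans ut)// ltW.
  have [pr pm] := past u u0 ut.
  rewrite /revised pr pm below ?yu// /removal /room winE ?u0// ltNge ut/=.
  by rewrite mulr0 subr0.
- move=> u /andP[u0 uy]; have ut := le_trans uy yt.
  have ur : u <= rho by rewrite (le_trans ut)// ltW.
  have [pr pm] := past u u0 ut.
  rewrite /revised pr pm ltNge above ?u0//= /removal winE ?u0// ltNge ut/=.
  by rewrite mulr0 subr0 addr0.
Qed.

End revision.

(** * The revision as a function of outcomes: thresholds, unbiasedness, variance *)

Section revised_estimator.
Context {R : realType} {V : Type} (S : monotone_sampling R V) (f : V -> R).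
Hypothesis f_ge0 : forall v, 0 <= f v.
Variables (e0 e : pestimator S) (r0 r : V -> R) (Z : set V) (v : V).
Hypotheses (per0 : partial_estimator f e0 r0) (per : partial_estimator f e r).
Hypothesis ext : forall o x, e0 o = Some x -> e o = Some x.
Hypotheses (Zv : Z v) (rZ : forall z, Z z -> r z = 0).
Variables (s rho h l d : R).
Hypotheses (rho01 : 0 < rho <= 1) (rho_le : rho <= r0 v).
Hypotheses (h0 : 0 < h) (hrho : h <= rho) (hs : s = 1 \/ s = -1) (d0 : 0 < d).
Let c := l + 3 * s * d.
Let c1 := l + 2 * s * d.
Let c2 := l + s * d.
Hypotheses (c1_ge0 : 0 <= c1) (c2_ge0 : 0 <= c2).
Hypothesis near_c : forall x, rho - h <= x -> x < rho ->
  Iint x rho (fun u => `|est e u v - c|) <= d / 2 * (rho - x).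
Local Notation mu := (@completed_lebesgue_measure R).

Let tip (w : V) (a : R) :=
  forall u, a < u <= 1 -> exists2 z, Z z & sample S u z = sample S u w.

Hypothesis slope : forall w, sample S rho w = sample S rho v -> r w = 0 -> tip w 0 ->
  exists eta : R, 0 <= eta < rho /\
    s * (Iint eta rho (est e ^~ w) - l * (rho - eta)) <= 0.
Hypothesis ceiling : s = -1 -> forall w a, sample S rho w = sample S rho v ->
  0 <= a -> a < rho -> tip w a -> l * (rho - a) + Iint rho 1 (est e ^~ v) <= f w.

Local Notation G := (revised e v s rho h c1 c2).

(** A property of the outcome alone; by [revised_sample] the value of [G] at the seed does not
    depend on the witness [w]. *)
Let affected (o : outcome S) := 0 < seed o <= rho /\
  exists w, sample S rho w = sample S rho v /\ sample S (seed o) w = o.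

(* Outcomes produced by no vector of [Z] are left unspecified: [lambda] does not
   control the data producing them, on which the balance could fail. *)
Definition revised_estimator : pestimator S := fun o =>
  match pselect (affected o) with
  | left p => if e0 o is Some x then Some x else
      if `[< exists2 z, Z z & sample S (seed o) z = o >] && isSome (e o)
      then Some (G (projT1 (cid p.2)) (seed o)) else None
  | right _ => e o
  end.
Local Notation g := revised_estimator.

Let rho0 : 0 < rho. Proof. by case/andP: rho01. Qed.
Let rho1 : rho <= 1. Proof. by case/andP: rho01. Qed.

Let seed_in (u : R) w : 0 < u -> u <= rho -> seed (sample S u w) = u.
Proof. by move=> u0 ur; apply: seed_sample; rewrite u0 (le_trans ur). Qed.

Lemma revised_out (u : R) w : 0 < u <= 1 -> rho < u \/ sample S rho w <> sample S rho v ->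
  g (sample S u w) = e (sample S u w).
Proof.
move=> u01 out; rewrite /revised_estimator; case: pselect => // p; exfalso; move: p.
rewrite /affected seed_sample// => -[/andP[u0 ur] [z [zv zw]]].
case: out; first by rewrite ltNge ur.
by apply; rewrite -zv; apply/esym/(sample_up u0 ur rho1 zw).
Qed.

Lemma revised_in (u : R) w : 0 < u -> u <= rho -> sample S rho w = sample S rho v ->
  e0 (sample S u w) = None -> g (sample S u w) =
    if `[< exists2 z, Z z & sample S u z = sample S u w >] && specified e u w
    then Some (G w u) else None.
Proof.
move=> u0 ur wv e0w; rewrite /revised_estimator; case: pselect => [p|np].
  rewrite e0w /specified; case: cid => z /= [zv].
  by rewrite seed_in// => zw; rewrite (revised_sample e v s h c1 c2 rho01 u0 ur zw).
by exfalso; apply: np; rewrite /affected seed_in// u0 ur; split=> //; exists w.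
Qed.

Lemma revised_extends o x : e0 o = Some x -> g o = Some x.
Proof.
move=> e0o; rewrite /revised_estimator; case: pselect => p; first by rewrite e0o.
exact: ext.
Qed.

Lemma revised_nonneg o x : g o = Some x -> 0 <= x.
Proof.
rewrite /revised_estimator; case: pselect => [p|_]; last exact: per.1.
case e0o : (e0 o) => [k|]; first by move=> [<-]; exact: per0.1 e0o.
case: ifP => // _ [<-]; apply: revised_ge0 => //.
exact: (est_ge0 per).
Qed.

(** By [Sstar_open], [w] and [v] also share their outcomes on an interval just below [rho]. There
    [e0] is unspecified, since [rho <= r0 v], which forces the threshold of [w] to be at least
    [rho]. *)
Lemma ae_unspecified0 w : sample S rho w = sample S rho v ->
  {ae mu, forall u : R, 0 < u <= rho -> e0 (sample S u w) = None}.
Proof.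
move=> wv; suff rw : rho <= r0 w.
  case: (partial_threshold per0 w) => _ _; apply: ae_imp => u unspec /andP[u0 ur].
  have := unspec; rewrite in_itv/= u0 (le_trans ur rw) => /(_ isT).
  by rewrite /specified; case: (e0 _).
have [d' d'0 dP] := Sstar_open rho01 ((Sstar_consistent _ _ _ rho01).2 wv).
pose a := Num.max 0 (rho - d').
have ar : a < rho by rewrite gt_max rho0 gtrBl.
apply: (threshold_ge (partial_threshold per0 w) ar) => //; first by rewrite le_max lexx.
case: (partial_threshold per0 v) => _ _; apply: ae_imp => u unspec /andP[].
rewrite gt_max => /andP[u0 du] ur.
have u01 : 0 < u <= 1 by rewrite u0 (le_trans ur).
have /(Sstar_consistent _ _ _ u01) uwv := dP u du u01.
rewrite /specified uwv.
by apply: unspec; rewrite in_itv/= u0 (le_trans ur).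
Qed.

Lemma revised_ae w a : sample S rho w = sample S rho v -> 0 <= a -> r w <= a -> tip w a ->
  {ae mu, forall u : R, a < u <= 1 -> specified g u w /\
    est g u w = if u <= rho then G w u else est e u w}.
Proof.
move=> wv a0 ra Pw; case: (partial_threshold per w) => _ spec _.
apply: ae_imp (ae_and (ae_unspecified0 wv) spec) => u [e0w eu] /andP[au u1].
have u0 : 0 < u by exact: le_lt_trans au.
have {}eu : specified e u w by apply: eu; rewrite in_itv/= u1 (le_lt_trans ra).
rewrite /specified /est; case: (leP u rho) => [ur|ru].
  rewrite revised_in ?e0w ?u0// eu andbT asboolT//.
  by apply: Pw; rewrite au.
have -> : g (sample S u w) = e (sample S u w).
  by apply: revised_out; [rewrite u0|left].
by split.
Qed.

Lemma revised_path w : sample S rho w = sample S rho v ->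
  exists t y, [/\ mass_transfer s rho t y c1 c2 (est e ^~ w) (G w),
    0 < Iint t rho (excess s c1 (est e ^~ w)),
    forall x, s = -1 -> 0 <= x -> x <= rho ->
      Iint x rho (G w) <= Iint x rho (est e ^~ w) \/
      Iint x rho (G w) <= c2 * (rho - x) &
    r w = 0 -> tip w 0 ->
      Iint y t (excess (- s) c2 (est e ^~ w)) = Iint t rho (excess s c1 (est e ^~ w))].
Proof.
move=> wv.
have [t [y [ht agree tr]]] := revised_transfer s c1 c2 rho01 h0 hrho (partial_integ per) wv.
have e_int : integ 0 rho (est e ^~ w) by exact: (partial_integS per).
have [t0 trho] := (transfer_t_ge0 tr, transfer_t_lt tr).
have near x : t <= x -> x < rho ->
    Iint x rho (fun u => `|est e u w - c|) <= d / 2 * (rho - x).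
  move=> tx xr; apply: le_trans (near_c (le_trans ht tx) xr).
  rewrite le_eqVlt; apply/orP; left; apply/eqP/Iint_eq => u /andP[xu ur].
  suff -> : est e u w = est e u v by [].
  by apply/est_sample/agree; rewrite ur (le_lt_trans tx).
exists t, y; split=> //.
- exact: (window_mass_gt0 hs t0 trho d0 e_int near).
- by move=> x s1 x0 xr; exact: (transfer_advanced hs t0 trho d0 e_int near tr).
(* If pouring stopped short of the removed mass it would have gone down to [y = 0], using all the
   room on []0, t]], which [window_capacity] shows to suffice. *)
- move=> rw0 Pw; have [eta [/andP[eta0 etar] heta]] := slope wv rw0 Pw.
  have cap := window_capacity hs t0 trho d0 e_int near eta0 etar heta.
  apply: le_anti; rewrite (transfer_fill_le tr)/= leNgt; apply/negP => lt1.
  have y0 := transfer_fill_end tr lt1.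
  by move: lt1; rewrite y0 ltNge cap.
Qed.

Let glued w u := if u <= rho then G w u else est e u w.

Lemma glued_Iint w (a : R) (F : R -> R) : 0 <= a -> a <= rho ->
  integ a rho (F \o G w) -> integ rho 1 (F \o est e ^~ w) ->
  integ a 1 (F \o glued w) /\
  Iint a 1 (F \o glued w) = Iint a rho (F \o G w) + Iint rho 1 (F \o est e ^~ w).
Proof.
move=> a0 ar I1 I2.
have E1 u : a < u <= rho -> (F \o G w) u = (F \o glued w) u.
  by move=> /andP[_ ur]; rewrite /glued /= ur.
have E2 u : rho < u <= 1 -> (F \o est e ^~ w) u = (F \o glued w) u.
  by move=> /andP[ru _]; rewrite /glued /= leNgt ru.
have I : integ a 1 (F \o glued w).
  by apply: (integ_cat ar rho1); [exact: integ_eq E1 I1|exact: integ_eq E2 I2].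
by split=> //; rewrite (Iint_cat ar rho1 I) -(Iint_eq E1) -(Iint_eq E2).
Qed.

Lemma revised_Iint w (a : R) (F : R -> R) : sample S rho w = sample S rho v ->
  0 <= a -> a <= rho -> r w <= a -> tip w a ->
  integ a rho (F \o G w) -> integ rho 1 (F \o est e ^~ w) ->
  integ a 1 (F \o est g ^~ w) /\
  Iint a 1 (F \o est g ^~ w) = Iint a rho (F \o G w) + Iint rho 1 (F \o est e ^~ w).
Proof.
move=> wv a0 ar ra Pw I1 I2; have [I <-] := glued_Iint a0 ar I1 I2.
have : {ae mu, forall u : R, a < u <= 1 -> (F \o glued w) u = (F \o est g ^~ w) u}.
  by apply: ae_imp (revised_ae wv a0 ra Pw) => u hu /hu[_ /= ->].
by move=> /ae_Iint/(_ I)[? ->].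
Qed.

(** The new threshold is the infimum of the seeds down to which [e] is specified for [w] and the
    outcomes are shared with [Z]. The seed [rho] qualifies because [v] lies in [Z] and is fully
    specified. Sharing persists at higher seeds, so no seed below the infimum can be both shared and
    above [r w]. *)
Lemma threshold_tip w : sample S rho w = sample S rho v ->
  exists a, [/\ 0 <= a <= rho, r w <= a, tip w a, threshold g w a & Z w -> a = 0].
Proof.
move=> wv.
have rw0 : 0 <= r w by case: (partial_threshold per w) => /andP[].
have tip_up u x : 0 < u -> u <= 1 -> (exists2 z, Z z & sample S u z = sample S u w) ->
    u <= x -> x <= 1 -> exists2 z, Z z & sample S x z = sample S x w.
  by move=> u0 u1 [z Zz zw] ux x1; exists z => //; exact: sample_up zw.
pose A := [set x | [/\ 0 <= x <= rho, r w <= x & tip w x]].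
have rw_rho : r w <= rho.
  apply: (threshold_le (partial_threshold per w)); first exact: ltW.
  case: (partial_threshold per v) => _ + _; rewrite rZ//.
  apply: ae_imp => u spec /andP[ru u1]; rewrite /specified.
  rewrite (sample_up rho0 (ltW ru) u1 wv); apply: spec.
  by rewrite in_itv/= u1 (lt_trans rho0).
have Arho : A rho.
  split=> //; first by rewrite lexx ltW.
  by move=> u /andP[ru u1]; exists v => //; apply/esym/(sample_up rho0 (ltW ru) u1 wv).
have infA : has_inf A by split; [exists rho|exists 0 => x [/andP[]]].
pose a := inf A.
have a0 : 0 <= a by apply: lb_le_inf; [exists rho|move=> x [/andP[]]].
have ar : a <= rho by exact: (ge_inf infA.2).
have ra : r w <= a by apply: lb_le_inf; [exists rho|move=> x []].
have Pa : tip w a.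
  move=> u /andP[au u1]; have [|x [_ _ Px] xu] := @inf_lt _ A u _ au; first by exists rho.
  by apply: Px; rewrite xu.
exists a; split=> //; first by rewrite a0.
- split; first by rewrite a0 (le_trans ar).
    by apply: ae_imp (revised_ae wv a0 ra Pa) => u hu; rewrite in_itv/= => /hu[].
  (* At the seed [a] itself the outcome may be specified; it is discarded as a null set. *)
  have neq_a : {ae mu, forall u : R, u <> a}.
    exists [set a]; split.
    - exact (measurable_completed (measurable_set1 a)).
    - exact: mu_set1.
    - by move=> u /= /contrapT.
  case: (partial_threshold per w) => _ _ unspec.
  apply: ae_imp (ae_and neq_a (ae_and unspec (ae_unspecified0 wv))) => u [ua [eu e0u]].
  rewrite in_itv/= => /andP[u0 ule]; have ur := le_trans ule ar.
  rewrite /specified revised_in ?e0u ?u0//; case: asboolP => //= Pu.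
  case: ifP => // spec; exfalso; apply: ua; apply: le_anti; rewrite ule/=.
  have ru : r w < u.
    by rewrite ltNge; apply/negP => ur'; move: spec; apply/negP/eu; rewrite in_itv/= u0.
  apply: (ge_inf infA.2); split; [by rewrite (ltW u0)|exact: ltW|].
  move=> x /andP[ux x1]; apply: (tip_up u x) => //; [exact: le_trans rho1|exact: ltW].
- move=> Zw; apply: le_anti; rewrite a0 andbT; apply: (ge_inf infA.2); split.
  + by rewrite lexx ltW.
  + by rewrite rZ.
  + by move=> u _; exists w.
Qed.

(** Data whose outcome at [rho] differs from that of [v] keep their estimates. For the others, a
    zero threshold makes the transfer balanced, and a positive one only requires an upper bound on
    the tail. *)
Lemma revised_partial : exists r', partial_estimator f g r' /\ forall z, Z z -> r' z = 0.
Proof.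
suff : forall w, exists a, [/\ threshold g w a, integ a 1 (est g ^~ w),
    0 < a -> Iint a 1 (est g ^~ w) <= f w, a = 0 -> Iint a 1 (est g ^~ w) = f w &
    Z w -> a = 0].
  move=> /choice[r' r'P]; exists r'; split; last by move=> z; case: (r'P z).
  split; first exact: revised_nonneg.
  move=> w; case: (r'P w) => th I le1 eq1 _; rewrite /tail_integral; split=> //.
  - by move=> /le1; rewrite Iint_EFin// lee_fin.
  - by move=> r'0; rewrite -{1}r'0 Iint_EFin// eq1.
move=> w; have [wv|wv] := pselect (sample S rho w = sample S rho v); last first.
  have gE u : 0 < u <= 1 -> g (sample S u w) = e (sample S u w).
    by move=> u01; apply: revised_out => //; right.
  case: (partial_threshold per w) => /andP[rw0 rw1] spec unspec.
  have estE u : r w < u <= 1 -> est e u w = est g u w.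
    by move=> /andP[ru u1]; rewrite /est gE// u1 (le_lt_trans rw0).
  have Iw : integ (r w) 1 (est e ^~ w) by exact: (partial_integS per).
  exists (r w); split.
  - split; first by rewrite rw0.
      apply: ae_imp spec => u hu uin; rewrite /specified gE; first exact: hu.
      by move: uin; rewrite in_itv/= => /andP[ru ->]; rewrite (le_lt_trans rw0).
    apply: ae_imp unspec => u hu uin; rewrite /specified gE; first exact: hu.
    by move: uin; rewrite in_itv/= => /andP[-> ur]; rewrite (le_trans ur).
  - exact: integ_eq estE Iw.
  - by move=> _; rewrite -(Iint_eq estE); exact: (partial_le per).
  - by move=> rw00; rewrite -(Iint_eq estE) rw00; exact: (partial_eq per).
  - exact: rZ.
have [a [/andP[a0 ar] ra Pa th Za]] := threshold_tip wv.
have [t [y [tr m0 adv bal]]] := revised_path wv.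
have e_int : integ 0 rho (est e ^~ w) by exact: (partial_integS per).
have G_int : integ a rho (G w) by apply: integS (transfer_integ tr e_int).
have e_int1 : integ rho 1 (est e ^~ w) by apply: (partial_integS per) => //; exact: ltW.
have [gI gE] := @revised_Iint w a id wv a0 ar ra Pa G_int e_int1.
have e_inta : integ a 1 (est e ^~ w) by exact: (partial_integS per).
have ele : Iint a 1 (est e ^~ w) <= f w.
  apply: le_trans (partial_le per w).
  have rw0 : 0 <= r w by case: (partial_threshold per w) => /andP[].
  apply: Iint_leS => //; first exact: (le_trans ar).
    exact: (partial_integS per).
  by move=> *; exact: (est_ge0 per).
have eE : Iint a 1 (est e ^~ w) = Iint a rho (est e ^~ w) + Iint rho 1 (est e ^~ w).
  by rewrite (@Iint_cat _ rho).
exists a; split=> //.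
- move=> apos; rewrite [X in X <= _]gE.
  (* For [s = 1] tails only drop. For [s = -1] a tail that rises stays below [c2 * (rho - a)], and
     [c2 < l] places it under [ceiling]. *)
  case: hs => s1.
    have := transfer_delayed tr e_int s1 a0 ar; move: ele; rewrite eE /=; lra.
  have [ar'|ra'] := ltP a rho; last first.
    have E : a = rho by apply: le_anti; rewrite ar.
    by move: ele; rewrite eE /= E !Iint_nil.
  have := ceiling s1 wv a0 ar' Pa; rewrite -(Iint_tail_sample e rho01 wv).
  case: (adv a s1 a0 ar); first by move: ele; rewrite eE /=; lra.
  have : 0 < d * (rho - a) by rewrite mulr_gt0// subr_gt0.
  by rewrite /c2 s1 /=; lra.
- move=> aE; rewrite [LHS]gE aE in ra Pa *.
  have rw0 : r w = 0.
    apply: le_anti; rewrite ra; by case: (partial_threshold per w) => /andP[].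
  have -> /= := transfer_balanced tr e_int (lexx 0) (transfer_y_ge0 tr) (bal rw0 Pa).
  by rewrite -(partial_eq per rw0) -aE eE aE.
Qed.

Lemma revised_variance_eq z : sample S rho z <> sample S rho v ->
  est_variance f g z = est_variance f e z.
Proof.
move=> zv; rewrite /est_variance; congr (_ - _)%E; apply: eq_integral => u.
rewrite inE/= in_itv/= => u01; rewrite /est revised_out//; by right.
Qed.

(** Finite variance makes the squared estimates integrable, and [transfer_sqr] lowers their integral
    by at least [2 * d] times the positive window mass. *)
Lemma revised_variance_lt z : Z z -> sample S rho z = sample S rho v ->
  (est_variance f e z < +oo)%E -> (est_variance f g z < est_variance f e z)%E.
Proof.
move=> Zz zv fin; pose sqr (x : R) := x ^+ 2.
have sq_int : integ 0 1 (sqr \o est e ^~ z).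
  apply/integrableP; split.
    apply/measurable_EFinP/measurable_funX.
    exact: integ_measurable (partial_integ per z).
  move: fin; rewrite /est_variance lteBlDr// => fin.
  under eq_integral do rewrite /= ger0_norm ?sqr_ge0//.
  by apply: lt_le_trans fin _; rewrite leey.
have [t [y [tr m0 adv bal]]] := revised_path zv.
have Pz : tip z 0 by move=> u _; exists z.
have rz := rZ Zz.
have e_int : integ 0 rho (est e ^~ z) by exact: (partial_integS per).
have sq_int0 : integ 0 rho (fun u => est e u z ^+ 2) by exact: integS sq_int.
have sq_int1 : integ rho 1 (sqr \o est e ^~ z) by apply: integS sq_int => //; exact: ltW.
have [Gsq Gle] := transfer_sqr tr e_int hs sq_int0 (bal rz Pz).
have r0z : r z <= 0 by rewrite rz.
have [gI gE] := revised_Iint (F := sqr) zv (lexx 0) (ltW rho0) r0z Pz Gsq sq_int1.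
rewrite /est_variance.
have -> : (\int[mu]_(u in `]0%R, 1%R]) ((est g u z) ^+ 2)%:E = (Iint 0 1 (sqr \o est g ^~ z))%:E)%E.
  exact: (Iint_EFin gI).
have -> : (\int[mu]_(u in `]0%R, 1%R]) ((est e u z) ^+ 2)%:E = (Iint 0 1 (sqr \o est e ^~ z))%:E)%E.
  exact: (Iint_EFin sq_int).
rewrite -!EFinB lte_fin ltrD2r gE (Iint_cat (ltW rho0) rho1 sq_int) ltrD2r.
apply: le_lt_trans Gle _; rewrite ltrBlDr ltrDl mulr_gt0// mulr_gt0//.
by rewrite (_ : s * (c1 - c2) = d)// /c1 /c2; case: hs => ->; lra.
Qed.

End revised_estimator.

(** * Choice of levels and contradiction with admissibility *)

Lemma ereal_dense_above (R : realType) (k : R) (x : \bar R) :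
  (k%:E < x)%E -> exists2 L : R, k < L & (L%:E <= x)%E.
Proof.
case: x => [x|_|//]; last by exists (k + 1); rewrite ?leey// ltrDl.
by rewrite lte_fin => kx; exists x.
Qed.

Lemma ereal_dense_below (R : realType) (k : R) (x : \bar R) :
  (0 <= x)%E -> (x < k%:E)%E -> exists L : R, [/\ 0 <= L, L < k & (x < L%:E)%E].
Proof.
case: x => [x|//|//]; rewrite lee_fin lte_fin => x0 xk.
by exists ((x + k) / 2); rewrite lte_fin; split; lra.
Qed.

Theorem theorem3p1 (R : realType) (V : Type) (S : monotone_sampling R V)
    (f : V -> R) (f_ge0 : forall v, 0 <= f v)
    (e0 : pestimator S) (rho : V -> R) (he0 : partial_estimator f e0 rho)
    (Z : set V) (e : pestimator S)
    (he : fully_specified_extension f e0 Z e)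
    (hadm : admissible f e0 Z e)
    (v : V) (hv : Z v) (hvar : (est_variance f e v < +oo)%E) :
  {ae (@completed_lebesgue_measure R), forall r : R, r \in `]0, rho v] ->
    (ereal_inf [set lambda f e v r z | z in Z `&` Sstar S r v]
       <= (est e r v)%:E)%E /\
    ((est e r v)%:E
       <= ereal_sup [set lambda f e v r z | z in Z `&` Sstar S r v])%E}.
Proof.
have [[[t per] ext] full] := he.
have tZ z : Z z -> t z = 0.
  move=> Zz; have := partial_threshold per z => th; apply: le_anti.
  have [_ spec _] := full z Zz; have [/andP[-> _] _ _] := th; rewrite andbT.
  by apply: (threshold_le th) => //; apply: ae_imp spec => u; rewrite in_itv.
have rho_v1 : rho v <= 1 by case: (partial_threshold he0 v) => /andP[].
apply: ae_imp (ae_left_lebesgue_pt (partial_integ per v)) => r near.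
rewrite in_itv/= => /andP[r0 rv]; have r1 := le_trans rv rho_v1.
have r01 : 0 < r <= 1 by rewrite r0.
have {}near := near r01.
have Sv z : sample S r z = sample S r v -> Sstar S r v z.
  by move=> zv; exact/(Sstar_consistent _ _ _ r01).
have est0 : 0 <= est e r v by exact: (est_ge0 per).
(* Any revision at [r] contradicts admissibility: it strictly lowers the variance at [v], finite by
   [hvar]. At any other [z] in [Z] it leaves the variance unchanged, lowers it, or starts from an
   infinite one. *)
have no_revision (s l d : R) : s = 1 \/ s = -1 -> 0 < d ->
    est e r v = l + 3 * s * d -> 0 <= l + 2 * s * d -> 0 <= l + s * d ->
    (forall w, sample S r w = sample S r v -> t w = 0 ->
      (forall u, 0 < u <= 1 -> exists2 z, Z z & sample S u z = sample S u w) ->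
      exists eta : R, 0 <= eta < r /\
        s * (Iint eta r (est e ^~ w) - l * (r - eta)) <= 0) ->
    (s = -1 -> forall w a, sample S r w = sample S r v -> 0 <= a -> a < r ->
      (forall u, a < u <= 1 -> exists2 z, Z z & sample S u z = sample S u w) ->
      l * (r - a) + Iint r 1 (est e ^~ v) <= f w) -> False.
  move=> hs d0 vE c1 c2 slope ceiling.
  have [|h0 h0_gt0 h0P] := near (d / 2); first by rewrite divr_gt0.
  pose h := Num.min h0 r.
  have h_gt0 : 0 < h by rewrite lt_min h0_gt0.
  have hr : h <= r by rewrite ge_min lexx orbT.
  have nearh x : r - h <= x -> x < r ->
      Iint x r (fun u => `|est e u v - (l + 3 * s * d)|) <= d / 2 * (r - x).
    rewrite -vE => hx xr; apply: h0P => //.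
      by apply: le_trans hx; rewrite subr_ge0.
    by apply: le_trans hx; rewrite lerD2l lerN2 ge_min lexx.
  pose g := revised_estimator e0 e Z v s r h l d.
  have gext : fully_specified_extension f e0 Z g.
    have [r' [per' r'Z]] : exists r', partial_estimator f g r' /\ forall z, Z z -> r' z = 0.
      exact: (revised_partial he0 per hv tZ r01 rv h_gt0 hr hs d0 c1 c2 nearh slope ceiling).
    split; first by split; [exists r'|exact: revised_extends].
    by move=> z Zz; rewrite /fully_specified -(r'Z z Zz); exact: partial_threshold per' z.
  have lt_v z : Z z -> sample S r z = sample S r v -> (est_variance f e z < +oo)%E ->
      (est_variance f g z < est_variance f e z)%E.
    exact: (revised_variance_lt he0 per tZ r01 rv h_gt0 hr hs d0 nearh slope).
  have [|z Zz] := hadm g gext; first by exists v => //; exact: lt_v.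
  apply/negP; rewrite -leNgt.
  have [zv|zv] := pselect (sample S r z = sample S r v); last by rewrite revised_variance_eq.
  have [fin|inf] := ltP (est_variance f e z) +oo%E; first exact/ltW/lt_v.
  by apply: le_trans inf; exact: leey.
split; rewrite leNgt; apply/negP.
  (* The estimate is below the infimum: [s = -1], [l = L], and [d] is a third of the gap so that
     [l - 3 * d] is the estimate. *)
  move=> /ereal_dense_above[L lL Linf].
  have lam z : Z z -> sample S r z = sample S r v -> (L%:E <= lambda f e v r z)%E.
    move=> Zz zv; apply: le_trans Linf _; apply: ereal_inf_lbound.
    by exists z => //; split=> //; exact: Sv.
  have L0 : 0 < L by exact: le_lt_trans lL.
  have above := slope_above f_ge0 per r01 L0 _ _ lam.
  apply: (no_revision (-1) L ((L - est e r v) / 3)); rewrite ?divr_gt0 ?subr_gt0//.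
  - by right.
  - by lra.
  - by lra.
  - by lra.
  (* Since [e] is unbiased at [w], [slope_above] at [a = 0] says that the mean of the estimates over
     []0, r]] is at least [L]. *)
  - move=> w wv tw Pw; exists 0; split; first by rewrite lexx.
    have := above 0 w (lexx 0) r0 wv Pw; rewrite subr0 -(partial_eq per tw).
    rewrite (Iint_cat (ltW r0) r1 (partial_integ per w)) (Iint_tail_sample e r01 wv).
    by lra.
  - by move=> _ w a wv a0 ar Pw; exact: above.
(* The vector [v] itself competes in the supremum. This permits a level [L >= 0], as [slope_below]
   and the nonnegativity of the clipping levels require. *)
have lam0 : (0 <= ereal_sup [set lambda f e v r z | z in Z `&` Sstar S r v])%E.
  apply: le_trans (lambda_ge0 f_ge0 per (tZ v hv) r01) _.
  by apply: ereal_sup_ubound; exists v => //; split=> //; exact: Sv.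
move=> /(ereal_dense_below lam0)[L [L0 lL supL]].
have lam z : Z z -> sample S r z = sample S r v -> (lambda f e v r z < L%:E)%E.
  move=> Zz zv; apply: le_lt_trans supL; apply: ereal_sup_ubound.
  by exists z => //; split=> //; exact: Sv.
(* [slope_below] needs a level strictly above [L], hence the midpoint; a sixth of the gap makes
   [l + 3 * d] the estimate. *)
apply: (no_revision 1 ((L + est e r v) / 2) ((est e r v - L) / 6)).
- by left.
- by rewrite divr_gt0 ?subr_gt0.
- by lra.
- by lra.
- by lra.
- move=> w wv tw Pw.
  have [|eta [etar le1]] := slope_below f_ge0 per r01 L0 _ lam wv tw Pw (l := (L + est e r v) / 2).
    by lra.
  by exists eta; split=> //; rewrite mul1r subr_le0.
- by move=> s1; exfalso; have := @ltr01 R; lra.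
Qed.
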